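(* Let $(R,\mathfrak m)$ be a commutative noetherian local ring with $\mathfrak m^3=0$ that is not Gorenstein, and let $e=\dim_{R/\mathfrak m}\mathfrak m/\mathfrak m^2$. If there is an exact zero divisor in $R$, and the residue field $k=R/\mathfrak m$ is algebraically closed, then there exists for each $n\in\mathbb N$ a family $\{M_n^\lambda\}_{\lambda\in k}$ of indecomposable and pairwise non-isomorphic totally reflexive $R$-modules with $\operatorname{length}_R M_n^\lambda=ne$ for every $\lambda\in k$. Moreover, the minimal free resolution of each module $M_n^\lambda$ is periodic of period at most $2$.
   Context: $\mathbb N=\{1,2,3,\dots\}$. For $x\in R$, $(0:x)$ denotes the annihilator of $x$. A non-invertible element $x\neq 0$ of $R$ is an exact zero divisor if there is an element $w\in R$ with $(0:x)=(w)$ and $(0:w)=(x)$. A finitely generated $R$-module $M$ is totally reflexive if there is an exact sequence $F\colon \cdots\to F_1\to F_0\to F_{-1}\to\cdots$ (infinite in both directions) of finitely generated free $R$-modules such that $M\cong\operatorname{Coker}(F_1\to F_0)$ and the dual sequence $\operatorname{Hom}_R(F,R)$ is also exact. *)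

(* Defs.v *)
From HB Require Import structures.
From mathcomp Require Import all_boot all_order all_algebra ring_quotient.
From mathcomp Require Import boolp classical_sets.

Set Implicit Arguments.
Unset Strict Implicit.
Unset Printing Implicit Defensive.

Import GRing.Theory.
Local Open Scope classical_set_scope.
Local Open Scope ring_scope.

Section Modules.
Variable R : comUnitRingType.
Implicit Types M N V : lmodType R.

Definition submodule M (N : set M) : Prop :=
  [/\ N 0, (forall x y, N x -> N y -> N (x + y))
    & forall (a : R) x, N x -> N (a *: x)].

Definition lspan M n (x : 'I_n -> M) : set M :=
  [set v | exists a : 'I_n -> R, v = \sum_i a i *: x i].

(* I N: finite sums of products of an element of I and an element of N *)
Definition ideal_mul M (I : set R) (N : set M) : set M :=
  [set v | exists n (a : 'I_n -> R) (x : 'I_n -> M),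
     [/\ forall i, I (a i), forall i, N (x i) & v = \sum_i a i *: x i]].

Definition isomorphic M N : Prop := exists f : {linear M -> N}, bijective f.

Definition fin_gen M : Prop := exists n (x : 'I_n -> M), lspan x = setT.

Definition fin_free M : Prop := exists n : nat, isomorphic 'rV[R]_n M.

Definition nontrivial M : Prop := exists x : M, x <> 0.

Definition indecomposable M : Prop :=
  nontrivial M /\
  forall A B : set M, submodule A -> submodule B ->
    A `&` B = [set 0] -> (forall x, exists a b, [/\ A a, B b & x = a + b]) ->
    A = [set 0] \/ B = [set 0].

(* M has a composition series with l simple factors. *)
Definition has_length M (l : nat) : Prop :=
  exists C : nat -> set M,
    [/\ C 0 = [set 0], C l = setT, (forall i, (i <= l)%N -> submodule (C i))
      & forall i, (i < l)%N ->
          [/\ C i `<=` C i.+1, C i <> C i.+1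
            & forall L, submodule L -> C i `<=` L -> L `<=` C i.+1 ->
                L = C i \/ L = C i.+1]].

Definition exact_at U V W (f : U -> V) (g : V -> W) (w0 : W) : Prop :=
  range f = g @^-1` [set w0].

(* p induces an isomorphism from Coker f onto M *)
Definition is_coker U V M (f : {linear U -> V}) (p : {linear V -> M}) : Prop :=
  range p = setT /\ exact_at f p 0.

Definition injective_module (E : lmodType R) : Prop :=
  forall (A B : lmodType R) (f : {linear A -> B}) (g : {linear A -> E}),
    injective f -> exists h : {linear B -> E}, forall x, h (f x) = g x.

(* 0 -> M -> I 0 -> ... -> I n -> 0 exact, with injective modules I i *)
Definition fin_inj_dim M : Prop :=
  exists (n : nat) (I : nat -> lmodType R) (eta : {linear M -> I 0})
         (d : forall i, {linear I i -> I i.+1}),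
    [/\ forall i, injective_module (I i),
        forall i, (n < i)%N -> ~ nontrivial (I i),
        injective eta,
        exact_at eta (d 0) 0
      & forall i, exact_at (d i) (d i.+1) 0].

(* d i is the differential F_{i+1} -> F_i.  The dual sequence is exact at
   Hom(F_{i+1}, R): a form is killed by precomposition with d (i + 1) iff it
   is a precomposition with d i. *)
Definition totally_reflexive M : Prop :=
  fin_gen M /\
  exists (F : int -> lmodType R) (d : forall i : int, {linear F (i + 1) -> F i}),
    [/\ forall i, fin_free (F i),
        forall i, exact_at (d (i + 1)) (d i) 0,
        forall (i : int) (phi : {linear F (i + 1) -> R^o}),
          (forall x, phi (d (i + 1) x) = 0) <->
          (exists psi : {linear F i -> R^o}, forall x, phi x = psi (d i x))
      & exists p : {linear F 0 -> M}, is_coker (d 0) p].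

Definition minimal_free_resolution (m : set R) M (F : nat -> lmodType R)
    (d : forall i, {linear F i.+1 -> F i}) (p : {linear F 0 -> M}) : Prop :=
  [/\ forall i, fin_free (F i),
      is_coker (d 0) p,
      forall i, exact_at (d i.+1) (d i) 0
    & forall i, range (d i) `<=` ideal_mul m setT].

(* The complex is isomorphic to its own truncation F_{>= q} shifted by q. *)
Definition periodic (F : nat -> lmodType R)
    (d : forall i, {linear F i.+1 -> F i}) (q : nat) : Prop :=
  exists phi : forall i, {linear F (i + q)%N -> F i},
    (forall i, bijective (phi i)) /\
    (forall i (x : F (i.+1 + q)%N), phi i (d (i + q)%N x) = d i (phi i.+1 x)).

(* Minimal free resolutions are unique only up to isomorphism, so the property
   is required of all of them, along with the existence of one. *)
Definition periodic_minimal_resolution_le2 (m : set R) M : Prop :=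
  (exists F d p, @minimal_free_resolution m M F d p) /\
  (forall F d p, @minimal_free_resolution m M F d p ->
     exists q, (0 < q <= 2)%N /\ periodic d q).

End Modules.

Section Rings.
Variable R : comUnitRingType.

Definition ideal (I : set R) : Prop := submodule (I : set R^o).

Definition noetherian : Prop :=
  forall I : set R, ideal I ->
    exists n (x : 'I_n -> R^o), lspan x = (I : set R^o).

Definition maximal_ideal (I : set R) : Prop :=
  [/\ ideal I, ~ I 1
    & forall J : set R, ideal J -> I `<=` J -> ~ J 1 -> J = I].

Definition local_with (m : set R) : Prop :=
  forall J : set R, maximal_ideal J <-> J = m.

Definition ideal_prod (I J : set R) : set R := ideal_mul I (J : set R^o).

Definition gorenstein : Prop := fin_inj_dim (R^o : lmodType R).

Definition ann (x : R) : set R := [set a | a * x = 0].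

Definition principal (x : R) : set R := [set a * x | a in setT].

Definition exact_zero_divisor (x : R) : Prop :=
  [/\ x \isn't a GRing.unit, x != 0
    & exists w : R, ann x = principal w /\ ann w = principal x].

(* dim_{R/m} m/m^2 = e: the classes of some x_0, ..., x_{e-1} in m form a
   basis of m/m^2 over R/m, written with representatives in R. *)
Definition cotangent_dim (m : set R) (e : nat) : Prop :=
  exists x : 'I_e -> R,
    [/\ forall i, m (x i),
        forall y, m y -> exists a : 'I_e -> R,
          ideal_prod m m (y - \sum_i a i * x i)
      & forall a : 'I_e -> R,
          ideal_prod m m (\sum_i a i * x i) -> forall i, m (a i)].

End Rings.
Arguments noetherian R : clear implicits.
Arguments gorenstein R : clear implicits.

(* Main.v *)
Require Import Defs.
From HB Require Import structures.
From mathcomp Require Import all_boot all_order all_algebra ring_quotient.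
From mathcomp Require Import finmap boolp classical_sets functions cardinality.
From mathcomp Require Import zify ring.

Set Implicit Arguments.
Unset Strict Implicit.
Unset Printing Implicit Defensive.

Import GRing.Theory.
Local Open Scope classical_set_scope.
Local Open Scope ring_scope.

(** Let [(x, w)] be an exact pair of zero divisors.  Since [R] is not
    Gorenstein, [e] is at least [2]: if [m] were principal, [R] would be a chain
    ring, which is injective over itself by Baer's criterion
    ([chain_ring_gorenstein], [cotangent_dim_gt1]).  Then neither [x] nor [w]
    lies in [m ^ 2], multiplication by [x] or by [w] maps [m] onto [m ^ 2], and
    [m ^ 2] is contained in [(x)], so that [R / (x)] has length [e].

    Choose [y] in [m] independent of [x] modulo [m ^ 2].  Being exact is an open
    condition on the pencil [x + l * y]: there is a polynomial [f] with [f(0) = 1]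
    such that [x + l * y] belongs to an exact pair when [f(l)] is a unit
    ([exact_pair_pencil]).  The residue field is infinite and [f] has finitely
    many zeros in it, so the residue field injects into the set of its elements
    at which [f] does not vanish ([injection_avoiding], [finite_mod_roots]).

    For such an [l] let [A] be the [n] by [n] Jordan block with [x + l * y] on
    the diagonal and [y] above it, and [N] the nilpotent block.  As [y * m] is
    contained in [(x + l * y) * m], one can solve for an upper triangular
    Toeplitz matrix [B], a polynomial in [N] whose constant term is the partner
    of [x + l * y], with [A * B = B * A = 0].  By triangularity, exactness on the
    diagonal gives exactness of the complexes formed with [A] and [B] and with
    their transposes ([tri_exact], [bidiag_exact_pair]).  Hence the cokernel of
    [A], realized as the kernel of [A], is totally reflexive with a minimal
    resolution of period at most [2], and any minimal resolution is isomorphic to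
    this one ([minimal_resolution_iso]).  It is an [n]-fold extension of copies of
    [R / (x + l * y)], which gives its length ([has_length_layers]).

    A homomorphism between the modules of [l] and [l'] lifts to a matrix [P]; by
    the independence of [x] and [y] modulo [m ^ 2], the reduction of [P] modulo
    [m] satisfies [(l - l') * P + N * P - P * N = 0] ([jordan_intertwine]).  If
    [l - l'] is a unit this forces [P = 0], so the modules are not isomorphic.  If
    [l = l'] then [P] commutes with [N] modulo [m], hence is upper triangular with
    constant diagonal, and idempotent endomorphisms are [0] or [1]. *)

(** * Submodules and linear maps *)

Section Generalities.
Variable R : comUnitRingType.
Implicit Types M N U V : lmodType R.

(** A linear map from a function with a proof of its linearity. *)
Definition mk_linear U V (f : U -> V) (lin_f : linear f) : {linear U -> V} :=
  HB.pack f (GRing.isLinear.Build R U V *:%R f lin_f).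

Lemma mk_linearE U V (f : U -> V) (lin_f : linear f) : mk_linear lin_f =1 f.
Proof. by []. Qed.

Lemma submoduleN M (A : set M) x : submodule A -> A x -> A (- x).
Proof. by move=> [_ _ AZ] Ax; rewrite -scaleN1r; apply: AZ. Qed.

Lemma submoduleB M (A : set M) x y : submodule A -> A x -> A y -> A (x - y).
Proof. by move=> sA Ax Ay; case: (sA) => _ AD _; apply: AD => //; exact: submoduleN. Qed.

Lemma submodule_sum M (A : set M) I (r : seq I) (P : pred I) (F : I -> M) :
  submodule A -> (forall i, P i -> A (F i)) -> A (\sum_(i <- r | P i) F i).
Proof. by move=> [A0 AD _] AF; apply: big_ind. Qed.

Lemma ideal_mul_submodule M (I : set R) (N : set M) : ideal I ->
  submodule (ideal_mul I N).
Proof.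
move=> [_ _ IZ]; split.
- by exists 0, (fun=> 0), (fun=> 0); split=> [[]|[]|] //; rewrite big_ord0.
- move=> _ _ [n1 [a1 [x1 [Ia1 Nx1 ->]]]] [n2 [a2 [x2 [Ia2 Nx2 ->]]]].
  pose pick T (f1 : 'I_n1 -> T) (f2 : 'I_n2 -> T) i :=
    match fintype.split i with inl i1 => f1 i1 | inr i2 => f2 i2 end.
  exists (n1 + n2)%N, (pick _ a1 a2), (pick _ x1 x2).
  split=> [i|i|]; [by rewrite /pick; case: fintype.split..|].
  rewrite big_split_ord /pick; congr (_ + _); apply: eq_bigr => i _.
    by rewrite (unsplitK (inl i)).
  by rewrite (unsplitK (inr i)).
- move=> r _ [n [a [x [Ia Nx ->]]]]; exists n, (fun i => r * a i), x.
  split=> // [i|]; first exact: (IZ r (a i)).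
  by rewrite scaler_sumr; apply: eq_bigr => i _; rewrite scalerA.
Qed.

Lemma ideal_mul_sub M (I : set R) (N P : set M) : submodule P ->
  (forall a x, I a -> N x -> P (a *: x)) -> ideal_mul I N `<=` P.
Proof.
move=> sP INP _ [n [a [x [Ia Nx ->]]]].
by apply: submodule_sum => // i _; exact: INP.
Qed.

Lemma ideal_mul_intro M (I : set R) (N : set M) a x :
  I a -> N x -> ideal_mul I N (a *: x).
Proof.
move=> Ia Nx; exists 1%N, (fun=> a), (fun=> x); split=> //.
by rewrite big_ord1.
Qed.

End Generalities.
Arguments submodule_sum {R M A I r P F}.

(** * Self-injectivity of chain rings *)

(** Baer's criterion.  Zorn's lemma is applied to the graphs of the partial
    linear maps from [B] to [E] that agree with [g] on the image of [f]. *)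
Lemma baer_criterion (R : comUnitRingType) (E : lmodType R) :
  (forall (I : set R) (phi : R -> E), ideal I ->
     (forall a b, I a -> I b -> phi (a + b) = phi a + phi b) ->
     (forall r a, I a -> phi (r * a) = r *: phi a) ->
     exists q, forall a, I a -> phi a = a *: q) ->
  injective_module E.
Proof.
move=> baerE A B f g f_inj.
pose P (G : set (B * E)) := [/\ forall u v, G u -> G v -> G (u + v),
  forall r u, G u -> G (r *: u) & forall a e, G (f a, e) -> e = g a].
(* The union of a chain, the empty one included, satisfies [P]; this is why [P]
   does not require a graph to contain [0]. *)
have [F FP Fch|G [GP Gmax]] := @Zorn_bigcup _ P.
  split.
  - move=> u v [X FX Xu] [Y FY Yv]; have [XY|YX] := Fch _ _ FX FY.
      by exists Y => //; case: (FP _ FY) => + _ _; apply=> //; exact: XY.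
    by exists X => //; case: (FP _ FX) => + _ _; apply=> //; exact: YX.
  - by move=> r u [X FX Xu]; exists X => //; case: (FP _ FX) => _ + _; apply.
  - by move=> a e [X FX /= Xae]; case: (FP _ FX) => _ _; apply.
have [GD GZ Gg] := GP.
have f0 : f 0 = 0 by rewrite linear0.
have G0 : G 0.
  apply: contrapT => nG0; apply: (Gmax [set 0]) => [|].
    split=> [u Gu|eG]; first by case: nG0; rewrite -(scale0r u); exact: GZ.
    by case: nG0; exact: eG.
  split=> [u v -> ->|r u ->|a e [fa ->]]; first by rewrite addr0.
    by rewrite scaler0.
  by rewrite -f0 in fa; rewrite (f_inj _ _ fa) linear0.
have GB u v : G u -> G v -> G (u - v).
  by move=> Gu Gv; apply: GD => //; rewrite -scaleN1r; exact: GZ.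
(* By maximality [G] contains every pair that can be added consistently. *)
have extend b q : (forall d s r a, G (d, s) -> d + r *: b = f a ->
    s + r *: q = g a) -> G (b, q).
  move=> bq; apply: contrapT => nG.
  apply: (Gmax [set u | exists2 v, G v & exists r, u = v + r *: (b, q)]).
    split=> [u Gu|eG]; first by exists u => //; exists 0; rewrite scale0r addr0.
    by apply: nG; apply: eG; exists 0 => //; exists 1; rewrite scale1r add0r.
  split.
  - move=> _ _ [u Gu [r ->]] [v Gv [s ->]]; exists (u + v); first exact: GD.
    by exists (r + s); rewrite scalerDl addrACA.
  - move=> r _ [u Gu [s ->]]; exists (r *: u); first exact: GZ.
    by exists (r * s); rewrite scalerDr scalerA.
  - by move=> a e [[d s] Gds [r [fa ->]]]; apply: (bq d s r a).
have Gfg a : G (f a, g a).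
  apply: extend => d s r a' Gds da.
  have e1 : d = f (a' - r *: a) by rewrite linearB linearZ -da addrK.
  move: Gds; rewrite e1 => /Gg ->; rewrite linearB linearZ.
  by rewrite subrK.
have Gfun b s s' : G (b, s) -> G (b, s') -> s = s'.
  move=> Gs Gs'; apply/eqP; rewrite -subr_eq0; apply/eqP.
  have : G (f 0, s - s') by rewrite f0 -(subrr b); exact: (GB _ _ Gs Gs').
  by move/Gg ->; rewrite linear0.
have Gtot b : exists q, G (b, q).
  pose I := [set r | exists s, G (r *: b, s)].
  pose phi r := xget 0 [set s | G (r *: b, s)].
  have phiP r : I r -> G (r *: b, phi r).
    by move=> [s Gs]; apply: (@xgetPex _ 0 [set s | G (r *: b, s)]); exists s.
  have [||r a Ia|q qP] := baerE I phi.
  - split=> [|x y [s Gs] [t Gt]|r x [s Gs]].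
    + by exists 0; rewrite scale0r; exact: G0.
    + by exists (s + t); rewrite scalerDl; exact: (GD _ _ Gs Gt).
    + by exists (r *: s); rewrite -scalerA; exact: (GZ _ _ Gs).
  - move=> x y Ix Iy; apply: (Gfun ((x + y) *: b)).
      apply: (phiP _); exists (phi x + phi y); rewrite scalerDl.
      exact: (GD _ _ (phiP _ Ix) (phiP _ Iy)).
    by rewrite scalerDl; exact: (GD _ _ (phiP _ Ix) (phiP _ Iy)).
  - apply: (Gfun ((r * a) *: b)).
      apply: (phiP _); exists (r *: phi a); rewrite -scalerA.
      exact: (GZ _ _ (phiP _ Ia)).
    by rewrite -scalerA; exact: (GZ _ _ (phiP _ Ia)).
  - exists q; apply: extend => d s r a Gds da.
    have Grb : G (r *: b, g a - s).
      have -> : r *: b = f a - d by rewrite -da addrC addKr.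
      exact: (GB _ _ (Gfg a) Gds).
    have Ir : I r by exists (g a - s).
    rewrite -(qP r Ir) (Gfun _ _ _ (phiP r Ir) Grb).
    by rewrite addrC subrK.
pose h b := xget 0 [set s | G (b, s)].
have hP b : G (b, h b) by apply: (@xgetPex _ 0 [set s | G (b, s)]); exact: Gtot.
have h_lin : linear h.
  move=> r b b'; apply: (Gfun (r *: b + b')) => //.
  exact: (GD _ _ (GZ r _ (hP b)) (hP b')).
by exists (mk_linear h_lin) => a; apply: (Gfun (f a)).
Qed.

Lemma injective_gorenstein (R : comUnitRingType) :
  injective_module (R^o : lmodType R) -> gorenstein R.
Proof.
move=> injR.
pose I i : lmodType R := if i is 0%N then R^o else 'rV[R]_0.
exists 0%N, I, (mk_linear (fun r (u v : R^o) => erefl (r *: u + v))).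
exists (fun i => \0%R : {linear I i -> I i.+1}); split.
- case=> [//|i] A B f g _; exists (\0%R : {linear B -> 'rV[R]_0}) => x.
  by rewrite [RHS](thinmx0 (g x)).
- by case=> // i _ [x]; apply; exact: thinmx0.
- by move=> x y.
- by apply/seteqP; split=> // x _; exists x.
- move=> i; apply/seteqP; split=> // x _; exists 0 => //.
  by rewrite [RHS](thinmx0 (x : 'rV[R]_0)).
Qed.

(** In the chain ring with ideals [(t^i)], [t^n = 0], the ideals are their own
    double annihilators, so that every linear map from an ideal to the ring is
    a multiplication. *)
Lemma chain_ring_gorenstein (R : comUnitRingType) (t : R) n :
  t ^+ n = 0 ->
  (forall a, a \is a GRing.unit \/ exists b, a = t * b) -> gorenstein R.
Proof.
move=> tn0 chain; apply/injective_gorenstein/baer_criterion => I phi.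
(* [v] is the least exponent with [t ^+ v = 0], and every element is a unit times
   a power of [t], or zero. *)
have [v /eqP tv0 vmin] : exists2 v, t ^+ v == 0 & forall i, t ^+ i == 0 -> (v <= i)%N.
  have ex : exists v, t ^+ v == 0 by exists n; rewrite tn0.
  by exists (ex_minn ex); case: ex_minnP.
have factor a : a = 0 \/ exists u i, u \is a GRing.unit /\ a = u * t ^+ i.
  suff [[b ->]|] // : (exists b, a = t ^+ v * b) \/
     exists u i, u \is a GRing.unit /\ a = u * t ^+ i.
    by left; rewrite tv0 mul0r.
    by right.
  elim: (v) => [|k [[b ab]|]]; [by left; exists a; rewrite mul1r| |by right].
  have [ub|[c bc]] := chain b; first by right; exists b, k; rewrite mulrC.
  by left; exists c; rewrite ab bc exprSr mulrA.
move=> [I0 ID IZ] phiD phiZ.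
(* The ideal [I] is generated by the least power of [t] that it contains. *)
have [i Iti imin] : exists2 i, I (t ^+ i) & forall j, I (t ^+ j) -> (i <= j)%N.
  have ex : exists i, `[< I (t ^+ i) >] by exists v; apply/asboolP; rewrite tv0.
  exists (ex_minn ex); case: ex_minnP => i /asboolP // _ im j Ij.
  by apply: im; apply/asboolP.
have iv : (i <= v)%N by apply: imin; rewrite tv0.
have Igen r : I r -> exists c, r = c * t ^+ i.
  move=> Ir; have [->|[u [j [uu rE]]]] := factor r; first by exists 0; rewrite mul0r.
  have Itj : I (t ^+ j).
    have -> : t ^+ j = u^-1 *: (r : R^o) by rewrite rE /GRing.scale /= mulrA mulVr ?mul1r.
    exact: IZ.
  exists (u * t ^+ (j - i)); rewrite -mulrA -exprD subnK //; exact: imin.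
(* [phi (t ^+ i)] is killed by [t ^+ (v - i)], hence is a multiple of [t ^+ i]. *)
have [q qP] : exists q, phi (t ^+ i) = t ^+ i * q.
  have z : t ^+ (v - i) * phi (t ^+ i) = 0.
    rewrite -[_ * _]/(_ *: (_ : R^o)) -phiZ // -exprD subnK // tv0.
    by have := phiZ 0 0 I0; rewrite mul0r scale0r.
  have [->|[u [j [uu sE]]]] := factor (phi (t ^+ i)).
    by exists 0; rewrite mulr0.
  suff ij : (i <= j)%N.
    by exists (u * t ^+ (j - i)); rewrite sE mulrCA -exprD subnKC.
  have : (v <= v - i + j)%N.
    apply: vmin; apply/eqP; move: z; rewrite sE mulrCA -exprD => z.
    by rewrite -[LHS]mul1r -(mulVr uu) -mulrA z mulr0.
  by move: iv; lia.
exists q => r /Igen [c ->].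
by rewrite phiZ // qP /GRing.scale /= mulrA.
Qed.

(** * Local rings with vanishing cube of the maximal ideal *)

Section CubeZero.
Variables (R : comUnitRingType) (m : idealr R).
Let mset : set R := [set x | x \in m].
Let m2 : set R := ideal_prod mset mset.

Lemma idealr_ideal : ideal mset.
Proof.
split=> [|x y|a x]; rewrite /mset /= ?rpred0 //; first exact: rpredD.
exact: idealMr.
Qed.

Lemma m2_submodule : submodule (m2 : set R^o).
Proof. exact/ideal_mul_submodule/idealr_ideal. Qed.

Lemma m2M a b : a \in m -> b \in m -> m2 (a * b).
Proof. by move=> ma mb; apply: (@ideal_mul_intro R R^o). Qed.

Hypothesis m_cube0 : ideal_prod mset m2 = [set 0].

Lemma m_m2_eq0 a z : a \in m -> m2 z -> a * z = 0.
Proof.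
move=> ma m2z; suff : ideal_prod mset m2 (a * z) by rewrite m_cube0.
exact: (@ideal_mul_intro R R^o).
Qed.

Lemma m3_eq0 a b c : a \in m -> b \in m -> c \in m -> a * (b * c) = 0.
Proof. by move=> ma mb mc; apply: m_m2_eq0 => //; exact: m2M. Qed.

Hypothesis localR : local_with mset.

(** An element outside [m] generates together with [m] the unit ideal, so a
   multiple of it is [1 - c] with [c] nilpotent. *)
Lemma notin_m_unit a : a \notin m -> a \is a GRing.unit.
Proof.
move=> am; have [mI m1 mmax] : maximal_ideal mset by apply/localR.
pose J : set R := [set x | exists c r, c \in m /\ x = c + r * a].
have [c [r [mc cra]]] : J 1.
  apply: contrapT => J1; move/negP: am; apply.
  have JE : J = mset.
    apply: mmax => //.
      split=> [|x y [c [r [mc ->]]] [d [s [md ->]]]|s x [c [r [mc ->]]]].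
      - by exists 0, 0; rewrite rpred0 mul0r addr0.
      - by exists (c + d), (r + s); rewrite rpredD // mulrDl addrACA.
      - exists (s * c), (s * r); rewrite idealMr //; split=> //.
        by rewrite /GRing.scale /= mulrDr mulrA.
    by move=> x mx; exists x, 0; rewrite mul0r addr0.
  have : J a by exists 0, 1; rewrite rpred0 mul1r add0r.
  by rewrite JE.
have raE : r * a = 1 - c by rewrite cra addrC addKr.
apply/unitrPr; exists (r * (1 + c + c * c)).
have -> : a * (r * (1 + c + c * c)) = r * a * (1 + c + c * c) by ring.
rewrite raE; have -> : (1 - c) * (1 + c + c * c) = 1 - c * (c * c) by ring.
by rewrite m3_eq0 // subr0.
Qed.

Lemma mM_notin a b : a * b \in m -> a \notin m -> b \in m.
Proof.
by move=> mab /notin_m_unit ua; rewrite -[b](mulKr ua); exact: idealMr.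
Qed.

(** ** Bases of the cotangent space *)

Section Basis.
Variables (e : nat) (b : 'I_e -> R).

(** Combination of the [b i] with coefficients in a column vector. *)
Definition comb (a : 'cV[R]_e) : R := \sum_i a i 0 * b i.

Lemma comb_is_linear : linear (comb : 'cV[R]_e -> R^o).
Proof.
move=> r a c; rewrite /comb scaler_sumr -big_split; apply: eq_bigr => i _ /=.
by rewrite !mxE mulrDl -mulrA.
Qed.
HB.instance Definition _ :=
  GRing.isLinear.Build R 'cV[R]_e R^o *:%R comb comb_is_linear.

Lemma combZ r a : comb (r *: a) = r * comb a.
Proof. by rewrite linearZ. Qed.

Lemma combB a c : comb (a - c) = comb a - comb c.
Proof. by rewrite linearB. Qed.

Lemma comb_delta i : comb (delta_mx i 0) = b i.
Proof.
rewrite /comb (bigD1 i) //= mxE !eqxx mul1r big1 ?addr0 // => j ji.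
by rewrite mxE (negbTE ji) mul0r.
Qed.

(** The classes of the [b i] form a basis of [m / m ^ 2] over [R / m]. *)
Definition m_basis := [/\ forall i, b i \in m,
   forall y, y \in m -> exists a, m2 (y - comb a)
   & forall a, m2 (comb a) -> forall i, a i 0 \in m].

Hypothesis bP : m_basis.

Lemma comb_m a : comb a \in m.
Proof. by case: bP => mb _ _; apply: rpred_sum => i _; exact: idealMr. Qed.

Lemma comb_m2 (a : 'cV[R]_e) : (forall i, a i 0 \in m) -> m2 (comb a).
Proof.
case: bP => mb _ _ ma; apply: (submodule_sum m2_submodule) => i _.
exact: m2M.
Qed.

(** As [m ^ 3 = 0], the [b i] generate [m], and [m ^ 2] consists of their
    combinations with coefficients in [m]. *)
Lemma comb_m2P z : m2 z -> exists2 a : 'cV[R]_e, forall i, a i 0 \in m & z = comb a.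
Proof.
case: bP => mb bgen _.
apply: (@ideal_mul_sub R R^o _ _
  [set z | exists2 a : 'cV[R]_e, forall i, a i 0 \in m & z = comb a]).
  split=> [|x y [a ma ->] [c mc ->]|r x [a ma ->]].
  - by exists 0 => [i|]; rewrite ?mxE ?rpred0 // linear0.
  - by exists (a + c) => [i|]; rewrite ?mxE ?rpredD // linearD.
  - by exists (r *: a) => [i|]; rewrite ?mxE ?idealMr // linearZ.
move=> p q mp mq; have [c m2c] := bgen q mq.
exists (p *: c) => [i|]; first by rewrite mxE mulrC idealMr.
have := m_m2_eq0 mp m2c; rewrite mulrBr => /eqP; rewrite subr_eq0 => /eqP pq.
by rewrite combZ -pq.
Qed.

Lemma combP y : y \in m -> exists a, y = comb a.
Proof.
case: bP => mb bgen _ my; have [a m2a] := bgen y my.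
have [c _ ca] := comb_m2P m2a; exists (c + a).
by rewrite linearD /= -ca subrK.
Qed.

End Basis.

(** ** Exact pairs of zero divisors *)

(** The ideals generated by [x] and [w] are each other's annihilators. *)
Definition exact_pair (x w : R) := [/\ x \in m, w \in m,
  forall a, a * x = 0 <-> exists r, a = r * w
  & forall a, a * w = 0 <-> exists r, a = r * x].

Lemma exact_pairC x w : exact_pair x w -> exact_pair w x.
Proof. by case. Qed.

Lemma exact_pair_mul0 x w : exact_pair x w -> w * x = 0.
Proof. by case=> _ _ + _ => ->; exists 1; rewrite mul1r. Qed.

Lemma exact_zero_divisor_pair x :
  exact_zero_divisor x -> exists w, exact_pair x w.
Proof.
case=> ux x0 [w [annx annw]]; exists w.
have exP (u v : R) : ann u = principal v -> forall a, a * u = 0 <-> exists r, a = r * v.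
  move=> uv a; split=> [au|[r ->]].
    by have : ann u a by []; rewrite uv => -[r _ <-]; exists r.
  by have : principal v (r * v) by [exists r]; rewrite -uv.
have mx : x \in m by apply: contrapT => /negP /notin_m_unit; apply/negP.
split=> //; [|exact: exP..].
apply: contrapT => /negP /notin_m_unit uw; move/eqP: x0; apply.
by rewrite -[x]mul1r; apply: (exP _ _ annx 1).2; exists w^-1; rewrite mulVr.
Qed.

(** The multiples of [z] by elements of [m] fill [m ^ 2]. *)
Definition fills_m2 z := forall t, m2 t -> exists2 r, r \in m & t = r * z.

Section Rank2.
Variables (e : nat) (b : 'I_e -> R).
Hypotheses (bP : m_basis b) (e_gt1 : (1 < e)%N).

Lemma m_not_cyclic z : z \in m -> ~ (forall a, a \in m -> exists r, a = r * z).
Proof.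
move=> mz zgen; have [mb _ bind] := bP.
pose i0 : 'I_e := Ordinal (ltnW e_gt1); pose i1 : 'I_e := Ordinal e_gt1.
have [r0 b0] := zgen _ (mb i0); have [r1 b1] := zgen _ (mb i1).
have : m2 (comb b (r1 *: delta_mx i0 0 - r0 *: delta_mx i1 0)).
  rewrite linearB /= !combZ !comb_delta b0 b1 mulrCA subrr.
  by case: m2_submodule.
move/bind => /(_ i0); rewrite !mxE !eqxx /= mulr0 subr0 mulr1 => mr1.
have : m2 (comb b (delta_mx i1 0)) by rewrite comb_delta b1; exact: m2M.
by move/bind => /(_ i1); rewrite !mxE !eqxx idealr1.
Qed.

(** Otherwise [w] would be killed by [m], and [m] would be generated by [x]. *)
Lemma exact_pair_notin_m2 x w : exact_pair x w -> ~ m2 w.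
Proof.
case=> mx mw _ annw m2w; apply: (m_not_cyclic mx) => a ma.
by apply/annw; exact: m_m2_eq0.
Qed.

Lemma exact_pair_fills x w : exact_pair x w -> fills_m2 w.
Proof.
move=> xw t m2t; have [mx mw annx _] := xw.
have [r tr] : exists r, t = r * w by apply/annx; rewrite mulrC m_m2_eq0.
exists r => //; apply: contrapT => /negP /notin_m_unit ur.
apply: (exact_pair_notin_m2 xw); rewrite -[w](mulKr ur) -tr.
by case: m2_submodule => _ _; exact.
Qed.

Lemma exact_pair_m2_neq0 x w : exact_pair x w -> exists2 t, m2 t & t != 0.
Proof.
move=> [mx mw annx _]; apply: contrapT => m20.
apply: (m_not_cyclic mw) => a ma; apply/annx; apply: contrapT => /eqP ax0.
by apply: m20; exists (a * x) => //; exact: m2M.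
Qed.

(** If the elements of [m] killed by [z] are multiples of one element [z']
    modulo [m ^ 2], then any [zb] in [m] that is killed by [z] and whose
    multiples fill [m ^ 2] generates the annihilator of [z]. *)
Lemma ann_principal z zb z' : z \in m -> zb \in m -> z' \in m -> zb * z = 0 ->
  fills_m2 z -> fills_m2 zb -> (exists2 t, m2 t & t != 0) ->
  (forall a, a \in m -> a * z = 0 -> exists r, m2 (a - r * z')) ->
  forall a, a * z = 0 <-> exists r, a = r * zb.
Proof.
move=> mz mzb mz' zbz fz fzb [t m2t t0] annz a; split; last first.
  by move=> [r ->]; rewrite -mulrA zbz mulr0.
move=> az; have ma : a \in m.
  apply: contrapT => /negP /notin_m_unit ua; move/eqP: t0; apply.
  have [r _ ->] := fz t m2t.
  by rewrite -[z](mulKr ua) az !mulr0.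
have [r m2r] := annz _ mzb zbz; have [s m2s] := annz _ ma az.
have [m20 m2D m2Z] := m2_submodule.
have ur : r \is a GRing.unit.
  apply: notin_m_unit; apply/negP => mr; move/eqP: t0; apply.
  have [p mp ->] := fzb t m2t; apply: m_m2_eq0 => //.
  by rewrite -(subrK (r * z') zb); apply: m2D => //; exact: m2M.
have : m2 (a - (s * r^-1) * zb).
  have -> : a - s * r^-1 * zb = (a - s * z') + (- (s * r^-1)) * (zb - r * z').
    by rewrite mulrBr !mulNr mulrA mulrVK //; ring.
  by apply: m2D => //; exact: m2Z.
move/fzb => [q _ /eqP]; rewrite subr_eq => /eqP ->; exists (q + s / r).
by rewrite mulrDl.
Qed.

(** ** Deforming an exact pair *)

(** Multiplication by [y] on [m] factors through multiplication by [x]. *)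
Lemma mul_matrix x y : fills_m2 x -> y \in m ->
  exists C : 'M[R]_e, forall a, y * comb b a = x * comb b (C *m a).
Proof.
move=> fx my; have [mb _ _] := bP.
have /choice[c cP] : forall j, exists c, y * b j = x * comb b c.
  move=> j; have [r mr ->] := fx _ (m2M my (mb j)).
  by have [c ->] := combP bP mr; exists c; rewrite mulrC.
exists (\matrix_(i, j) c j i 0) => a.
have -> : \matrix_(i, j) c j i 0 *m a = \sum_j a j 0 *: c j.
  apply/colP => i; rewrite !mxE summxE; apply: eq_bigr => j _.
  by rewrite !mxE mulrC.
rewrite linear_sum /comb !mulr_sumr; apply: eq_bigr => j _ /=.
rewrite -/(comb b _) combZ [RHS]mulrCA -cP; ring.
Qed.

Lemma fills_deform z z0 (T : 'M[R]_e) : T \in unitmx -> fills_m2 z0 ->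
  (forall a, z * comb b a = z0 * comb b (T *m a)) -> fills_m2 z.
Proof.
move=> uT fz0 zE t /fz0[r mr ->]; have [c ->] := combP bP mr.
exists (comb b (invmx T *m c)); first exact: comb_m.
by rewrite mulrC -{1}(mulKVmx uT c) -zE mulrC.
Qed.

Lemma ann_deform z z0 z0' (T : 'M[R]_e) : T \in unitmx ->
  (forall a, a * z0 = 0 <-> exists r, a = r * z0') -> z0' \in m ->
  (forall a, z * comb b a = z0 * comb b (T *m a)) ->
  exists2 z', z' \in m & forall a, a \in m -> a * z = 0 -> exists r, m2 (a - r * z').
Proof.
move=> uT ann0 mz0' zE; have [ze z0E] := combP bP mz0'; have [_ _ bind] := bP.
exists (comb b (invmx T *m ze)) => [|a ma]; first exact: comb_m.
have [c ->] := combP bP ma; rewrite mulrC zE mulrC => /ann0[r].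
rewrite z0E -combZ => /eqP; rewrite -subr_eq0 -linearB => /eqP cr; exists r.
have md : forall i, (T *m c - r *: ze) i 0 \in m.
  by apply: bind; rewrite cr; case: m2_submodule.
rewrite -combZ -linearB /=; apply: (comb_m2 bP) => i.
have -> : c - r *: (invmx T *m ze) = invmx T *m (T *m c - r *: ze).
  by rewrite mulmxBr mulKmx // scalemxAr.
by rewrite mxE; apply: rpred_sum => j _; exact: idealMr.
Qed.

(** A pencil [x + l * y] of zero divisors through an exact one: outside the
    zeros modulo [m] of a polynomial that does not vanish at [0], its members
    are exact.  In the basis [b], multiplication by [x + l * y] is
    multiplication by [x] after [1 + l * C], and the partner of [x + l * y] is
    found with the adjugate of this matrix; the partner in turn is the partner
    of [x] times a matrix that depends polynomially on [l]. *)
Lemma exact_pair_pencil x0 w0 : exact_pair x0 w0 ->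
  exists (y : R) (f : {poly R}), [/\ y \in m,
    forall p q, m2 (p * x0 + q * y) -> p \in m /\ q \in m,
    f.[0] = 1
    & forall l, f.[l] \notin m -> exists w, exact_pair (x0 + l * y) w].
Proof.
move=> xw; have [mx0 mw0 annx annw] := xw; have [mb _ bind] := bP.
have fw := exact_pair_fills xw; have fx := exact_pair_fills (exact_pairC xw).
have [ze x0E] := combP bP mx0; have [om w0E] := combP bP mw0.
(* [x0] has a unit coordinate at [i0]; any other basis element serves as [y]. *)
have [i0 zi0] : exists i, ze i 0 \notin m.
  apply: contrapT => /forallNP mze.
  apply: (exact_pair_notin_m2 (exact_pairC xw)); rewrite x0E.
  by apply: (comb_m2 bP) => i; apply: contrapT => /negP; exact: mze.
have [i1 i10] : exists i1, i1 != i0.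
  case: (altP (i0 =P Ordinal e_gt1)) => [->|]; last by exists (Ordinal e_gt1); rewrite eq_sym.
  by exists (Ordinal (ltnW e_gt1)).
have [C CP] := mul_matrix fx (mb i1).
have /choice[D DP] : forall i, exists D : 'M[R]_e, forall a, b i * comb b a = w0 * comb b (D *m a).
  by move=> i; exact: mul_matrix.
(* With the indeterminate for [l], [x0 + l * y] is [x0] after [M1], the
   coordinates [Om] of its partner are those of [w0] transformed by the adjugate
   of [M1], and multiplication by the partner is multiplication by [w0] after
   [M2].  Writing [M2] as the identity plus a deviation, rather than as the sum
   of the [Om i 0 *: D i], makes it the identity at [0]. *)
pose M1 : 'M[{poly R}]_e := 1%:M + 'X *: map_mx polyC C.
pose Om : 'cV[{poly R}]_e := \adj M1 *m map_mx polyC om.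
pose M2 : 'M[{poly R}]_e :=
  1%:M + \sum_i (Om i 0 - (om i 0)%:P) *: map_mx polyC (D i).
pose ev l : {rmorphism {poly R} -> R} := horner_eval l.
have evC l p q (A : 'M[R]_(p, q)) : map_mx (ev l) (map_mx polyC A) = A.
  by apply/matrixP => i j; rewrite !mxE /= /horner_eval hornerC.
have M1E l : map_mx (ev l) M1 = 1%:M + l *: C.
  apply/matrixP => i j; rewrite !mxE rmorphD rmorphM rmorph_nat /= /horner_eval.
  by rewrite hornerX hornerC.
have OmE l : map_mx (ev l) Om = \adj (1%:M + l *: C) *m om.
  by rewrite map_mxM evC map_mx_adj M1E.
have M2E l : map_mx (ev l) M2 =
    1%:M + \sum_i ((map_mx (ev l) Om) i 0 - om i 0) *: D i.
  apply/matrixP => i j; rewrite !mxE rmorphD rmorph_nat !summxE rmorph_sum.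
  congr (_ + _); apply: eq_bigr => k _; rewrite !mxE rmorphM rmorphB /=.
  by rewrite /horner_eval !hornerC.
have detE l : (\det M1 * \det M2).[l] =
    \det (map_mx (ev l) M1) * \det (map_mx (ev l) M2).
  by rewrite !det_map_mx -rmorphM.
exists (b i1), (\det M1 * \det M2); split=> [||| l fl] //.
- move=> p q; rewrite x0E -(comb_delta b) -!combZ -linearD => /bind pq.
  have mp : p \in m.
    apply: (@mM_notin (ze i0 0)) => //; have := pq i0.
    by rewrite !mxE [i0 == i1]eq_sym (negbTE i10) mulr0 addr0 mulrC.
  split=> //; have := pq i1; rewrite !mxE !eqxx mulr1 => mpq.
  by rewrite -(addKr (p * ze i1 0) q) rpredD // rpredN mulrC idealMr.
- rewrite detE M2E OmE M1E scale0r addr0 adj1 mul1mx det1 mul1r big1 ?addr0 ?det1 //.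
  by move=> i _; rewrite subrr scale0r.
- pose T1 := map_mx (ev l) M1; pose T2 := map_mx (ev l) M2.
  have uf : \det T1 * \det T2 \is a GRing.unit by rewrite -detE; exact: notin_m_unit.
  have [uT1 uT2] : T1 \in unitmx /\ T2 \in unitmx.
    by move: uf; rewrite unitrM !unitmxE => /andP[].
  pose oml := \adj T1 *m om.
  have xE a : (x0 + l * b i1) * comb b a = x0 * comb b (T1 *m a).
    rewrite mulrDl -mulrA CP /T1 M1E mulmxDl mul1mx linearD /= mulrDr.
    by rewrite -scalemxAl combZ; congr (_ + _); rewrite mulrCA.
  have wE a : comb b oml * comb b a = w0 * comb b (T2 *m a).
    have combM (c : 'cV_e) : comb b c * comb b a = \sum_i c i 0 * (w0 * comb b (D i *m a)).
      by rewrite mulr_suml; apply: eq_bigr => i _; rewrite -mulrA DP.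
    rewrite /T2 M2E mulmxDl mul1mx linearD /= mulrDr {1}w0E 2!combM.
    rewrite mulmx_suml linear_sum mulr_sumr -big_split /=.
    apply: eq_bigr => i _; rewrite -scalemxAl combZ OmE -M1E -/T1 -/oml; ring.
  have xw0 : (x0 + l * b i1) * comb b oml = 0.
    rewrite xE /oml mulmxA mul_mx_adj mul_scalar_mx combZ -w0E mulrCA.
    by rewrite (exact_pair_mul0 (exact_pairC xw)) mulr0.
  exists (comb b oml).
  have mx : x0 + l * b i1 \in m by rewrite rpredD // idealMr.
  have mw : comb b oml \in m by exact: comb_m.
  have fxl := fills_deform uT1 fx xE; have fwl := fills_deform uT2 fw wE.
  have nz := exact_pair_m2_neq0 xw.
  have [zx mzx zxP] := ann_deform uT1 annx mw0 xE.
  have [zw mzw zwP] := ann_deform uT2 annw mx0 wE.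
  split=> //.
  + by apply: (ann_principal mx mw mzx) => //; rewrite mulrC.
  + exact: (ann_principal mw mx mzw).
Qed.

End Rank2.
End CubeZero.

(** * Modules presented by matrix factorizations of zero *)

(** A square matrix that is triangular for the order on the indices given by
    [h], with constant diagonal [a]. *)
Definition tri_const (R : comUnitRingType) n (h : 'I_n -> nat) (A : 'M[R]_n) a :=
  (forall i j, A i j != 0 -> (h i <= h j)%N) /\ forall i, A i i = a.

(** The entries of [u] are cleared in the order given by [h]: the first nonzero
   one is killed by [a], hence is the first one of a multiple of a row of [B]. *)
Lemma tri_exact (R : comUnitRingType) n (h : 'I_n -> nat) (A B : 'M[R]_n) a b :
  injective h -> tri_const h A a -> tri_const h B b -> B *m A = 0 ->
  (forall r, r * a = 0 -> exists s, r = s * b) ->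
  forall u : 'rV_n, u *m A = 0 -> exists v, u = v *m B.
Proof.
move=> h_inj [Atri Adiag] [Btri Bdiag] BA0 ab.
have tri0 (C : 'M[R]_n) i j : (forall i j, C i j != 0 -> (h i <= h j)%N) ->
    (h j < h i)%N -> C i j = 0.
  by move=> Ctri hji; apply/eqP; apply: contraLR hji => /Ctri; rewrite -leqNgt.
pose K := (\max_i h i).+1.
suff sweep d k (u : 'rV_n) : (K - k <= d)%N -> u *m A = 0 ->
    (forall i, (h i < k)%N -> u 0 i = 0) -> exists v, u = v *m B.
  by move=> u uA; apply: (sweep K 0%N) => //; rewrite leq_subr.
elim: d k u => [|d IH] k u Kk uA u0.
  exists 0; rewrite mul0mx; apply/rowP => i; rewrite mxE u0 //.
  by move: (@leq_bigmax _ h i) Kk; rewrite /K; lia.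
have [[i hik]|noi] := pselect (exists i, h i = k); last first.
  apply: (IH k.+1) => // [|i]; first by lia.
  by rewrite ltnS leq_eqVlt => /orP[/eqP hik|]; [case: noi; exists i|exact: u0].
have [s us] : exists s, u 0 i = s * b.
  apply: ab; have := congr1 (fun v : 'rV_n => v 0 i) uA.
  rewrite !mxE (bigD1 i) //= Adiag big1 ?addr0 // => j ji.
  have [hji|hij|hji] := ltngtP (h j) (h i).
  - by rewrite u0 ?mul0r // -hik.
  - by rewrite (tri0 A) // mulr0.
  - by move/h_inj: hji ji => ->; rewrite eqxx.
have [||j|v vE] := IH k.+1 (u - s *: row i B).
- by lia.
- by rewrite mulmxBl uA -scalemxAl -row_mul BA0 row0 scaler0 subr0.
- rewrite ltnS leq_eqVlt !mxE => /orP[/eqP hjk|hjk].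
    by rewrite (h_inj j i) ?Bdiag ?us ?subrr // hik.
  by rewrite u0 // (tri0 B) ?hik // mulr0 subr0.
- exists (v + s *: delta_mx 0 i).
  by rewrite mulmxDl -vE -scalemxAl -rowE subrK.
Qed.

(** The kernel of the endomorphism of ['rV_n] given by right multiplication by a
    matrix [A].  When [A] is the first of an exact pair of matrices, this is the
    cokernel of [A] realized as a submodule. *)
Section KernelModule.
Variables (R : comUnitRingType) (n : nat) (A : 'M[R]_n).

Definition ker_pred : {pred 'rV[R]_n} := [pred u | u *m A == 0].

Lemma ker_submod_closed : submod_closed ker_pred.
Proof.
split=> [|a u v]; rewrite !inE ?mul0mx // => /eqP uA /eqP vA.
by rewrite mulmxDl -scalemxAl uA vA scaler0 addr0.
Qed.
HB.instance Definition _ :=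
  GRing.isSubmodClosed.Build R 'rV[R]_n ker_pred ker_submod_closed.

Record ker_mod := KerMod { ker_val : 'rV[R]_n; _ : ker_val \in ker_pred }.

HB.instance Definition _ := [isSub for ker_val].
HB.instance Definition _ := [Choice of ker_mod by <:].
HB.instance Definition _ := [SubChoice_isSubLmodule of ker_mod by <:].

Lemma ker_valP (u : ker_mod) : val u *m A = 0.
Proof. by apply/eqP; exact: (valP u). Qed.

End KernelModule.

(** A pair of square matrices with entries in [m] such that the periodic
    complexes that alternate them are exact, for their actions both on row
    vectors and on column vectors; the latter is the dual complex. *)
Definition exact_mx_pair (R : comUnitRingType) (m : idealr R) n (A B : 'M[R]_n) :=
  [/\ A *m B = 0, B *m A = 0, (forall i j, A i j \in m) /\ (forall i j, B i j \in m),
    (forall u : 'rV_n, u *m A = 0 -> exists v, u = v *m B) /\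
    (forall u : 'rV_n, u *m B = 0 -> exists v, u = v *m A)
    & (forall c : 'cV_n, A *m c = 0 -> exists d, c = B *m d) /\
      (forall c : 'cV_n, B *m c = 0 -> exists d, c = A *m d)].

Section MatrixPair.
Variables (R : comUnitRingType) (m : idealr R) (n : nat) (A B : 'M[R]_n).
Hypothesis AB : exact_mx_pair m A B.

Let ker_proj_sub u : u *m B \in ker_pred A.
Proof. by case: AB => _ BA _ _ _; rewrite inE -mulmxA BA mulmx0. Qed.

Let ker_proj_linear : linear (fun u => KerMod (ker_proj_sub u)).
Proof.
by move=> r u v; apply: val_inj; rewrite /= mulmxDl -scalemxAl.
Qed.

(** The projection of the cokernel of [A] onto the kernel of [A]. *)
Definition ker_proj : {linear 'rV[R]_n -> ker_mod A} := mk_linear ker_proj_linear.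

Lemma ker_projE u : val (ker_proj u) = u *m B.
Proof. by []. Qed.

Lemma ker_proj_surj z : exists u, ker_proj u = z.
Proof.
case: AB => _ _ _ [kerA _] _; have [u uE] := kerA _ (ker_valP z).
by exists u; apply: val_inj; rewrite uE.
Qed.

Lemma ker_proj_eq0 u : ker_proj u = 0 <-> exists v, u = v *m A.
Proof.
case: AB => AB0 _ _ [_ kerB] _; split=> [/(congr1 val)|[v ->]].
  exact: kerB.
by apply: val_inj; rewrite ker_projE -mulmxA AB0 mulmx0.
Qed.

Lemma ker_proj_coker : is_coker (mulmxr A : {linear 'rV[R]_n -> 'rV[R]_n}) ker_proj.
Proof.
split; first by apply/seteqP; split=> // z _; have [u <-] := ker_proj_surj z; exists u.
apply/seteqP; split=> [_ [v _ <-]|u /ker_proj_eq0 [v ->]]; last by exists v.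
by apply/ker_proj_eq0; exists v.
Qed.

Lemma mulmxr_exact : exact_at (mulmxr A : 'rV_n -> 'rV_n) (mulmxr B : 'rV_n -> 'rV_n) 0.
Proof.
case: AB => AB0 _ _ [_ kerB] _; apply/seteqP; split=> [_ [v _ <-]|u /= /kerB[v ->]].
  by rewrite /= -mulmxA AB0 mulmx0.
by exists v.
Qed.

Lemma mulmxr_dual_exact (phi : {linear 'rV[R]_n -> R^o}) :
  (forall u : 'rV_n, phi (u *m A) = 0) <->
  exists psi : {linear 'rV[R]_n -> R^o}, forall u : 'rV_n, phi u = psi (u *m B).
Proof.
case: AB => AB0 _ _ _ [colA _]; split=> [phiA|[psi phiE] u]; last first.
  by rewrite phiE -mulmxA AB0 mulmx0 linear0.
pose c : 'cV[R]_n := \col_i phi (delta_mx 0 i).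
have phic (u : 'rV_n) : phi u = (u *m c) 0 0.
  rewrite {1}[u]row_sum_delta linear_sum mxE; apply: eq_bigr => i _ /=.
  by rewrite linearZ mxE.
have [|d cE] := colA c.
  apply/colP => i; rewrite mxE; have := phiA (delta_mx 0 i).
  by rewrite phic -mulmxA -rowE !mxE.
have psi_lin : linear ((fun u : 'rV_n => (u *m d) 0 0) : 'rV_n -> R^o).
  by move=> r u v; rewrite mulmxDl -scalemxAl !mxE.
by exists (mk_linear psi_lin) => u; rewrite phic cE mulmxA.
Qed.

Lemma mulmxr_minimal : range (mulmxr A : 'rV_n -> 'rV_n) `<=`
  ideal_mul [set x | x \in m] [set: 'rV[R]_n].
Proof.
case: AB => _ _ [mA _] _ _ _ [u _ <-] /=.
exists n, (fun j => (u *m A) 0 j), (fun j => delta_mx 0 j); split=> // [j|].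
  by rewrite mxE /=; apply: rpred_sum => i _; exact: idealMr.
by rewrite {1}[u *m A]row_sum_delta.
Qed.

End MatrixPair.

Lemma exact_mx_pairC (R : comUnitRingType) (m : idealr R) n (A B : 'M[R]_n) :
  exact_mx_pair m A B -> exact_mx_pair m B A.
Proof. by case=> ? ? [? ?] [? ?] [? ?]. Qed.

(** * Uniqueness of minimal free resolutions *)

Lemma inj_surj_bijective U V (f : U -> V) :
  injective f -> (forall y, exists x, f x = y) -> bijective f.
Proof.
move=> f_inj /choice[g gP]; exists g => // x.
by apply: f_inj; rewrite gP.
Qed.

Lemma bijective_linear_inv (R : comUnitRingType) (U V : lmodType R)
    (f : {linear U -> V}) : bijective f ->
  exists g : {linear V -> U}, cancel f g /\ cancel g f.
Proof.
move=> [g fK gK]; have g_lin : linear g.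
  by move=> r x y; apply: (can_inj fK); rewrite linearP !gK.
by exists (mk_linear g_lin).
Qed.

Lemma fin_free_lift (R : comUnitRingType) (F M N : lmodType R)
    (f : {linear F -> N}) (g : {linear M -> N}) : fin_free F ->
  range f `<=` range g -> exists h : {linear F -> M}, forall x, g (h x) = f x.
Proof.
move=> [n [phi /bijective_linear_inv[psi [phiK psiK]]]] fg.
have /choice[y yP] : forall i : 'I_n, exists y, g y = f (phi (delta_mx 0 i)).
  move=> i; have [|y _ yE] := fg (f (phi (delta_mx 0 i))); last by exists y.
  by exists (phi (delta_mx 0 i)).
have h_lin : linear (fun x => \sum_i psi x 0 i *: y i).
  move=> r u v; rewrite scaler_sumr -big_split; apply: eq_bigr => i _ /=.
  by rewrite linearP !mxE scalerDl scalerA.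
exists (mk_linear h_lin) => x; rewrite mk_linearE linear_sum.
rewrite -[in RHS](psiK x) {2}[psi x]row_sum_delta !linear_sum.
by apply: eq_bigr => i _; rewrite !linearZ /= yP.
Qed.

Section Minimal.
Variables (R : comUnitRingType) (m : idealr R).
Let mset : set R := [set x | x \in m].
Hypothesis m_cube0 : ideal_prod mset (ideal_prod mset mset) = [set 0].

(** An endomorphism with values in [m F] maps [m ^ i F] to [m ^ (i + 1) F], so
    its cube vanishes. *)
Lemma linear_nilpotent (F : lmodType R) (eps : {linear F -> F}) :
  (forall x, ideal_mul mset setT (eps x)) -> forall x, eps (eps (eps x)) = 0.
Proof.
move=> epsm x.
have epsM (N N' : set F) : (forall x, N x -> N' (eps x)) ->
    forall x, ideal_mul mset N x -> ideal_mul mset N' (eps x).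
  move=> NN' _ [n [a [y [ma Ny ->]]]]; exists n, a, (fun i => eps (y i)).
  split=> // [i|]; first exact: NN'.
  by rewrite linear_sum; apply: eq_bigr => i _; rewrite linearZ.
have /(_ (eps (eps (eps x)))) : ideal_mul mset (ideal_mul mset (ideal_mul mset setT)) `<=`
    [set 0 : F].
  have kill_sub (I : set R) : submodule [set y : F | forall c, I c -> c *: y = 0].
    split=> [c _|y z y0 z0 c Ic|r y y0 c Ic]; first by rewrite scaler0.
      by rewrite scalerDr y0 // z0 // addr0.
    by rewrite scalerA mulrC -scalerA y0 // scaler0.
  apply: ideal_mul_sub => [|a y ma m2y /=].
    by split=> [|u v -> ->|r u ->] //=; rewrite ?addr0 ?scaler0.
  move: a ma; apply: (ideal_mul_sub (kill_sub mset)) m2y => b y' mb my a ma.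
  rewrite scalerA; pose I := [set c | exists2 a, a \in m & exists2 b, b \in m & c = a * b].
  have Iab : I (a * b) by exists a => //; exists b.
  move: (a * b) Iab; apply: (ideal_mul_sub (kill_sub I)) my => c z mc _ _ [a' ma' [b' mb' ->]].
  by rewrite scalerA -mulrA (m3_eq0 m_cube0) // scale0r.
apply; have eps2 y := epsM setT _ (fun y _ => epsm y) y.
exact: (epsM _ _ eps2 _ (eps2 _ (epsm x))).
Qed.

(** Minimal free covers of the same submodule are isomorphic: the composites
    of lifts in both directions are the identity up to a nilpotent. *)
Lemma minimal_cover_iso (F G M : lmodType R) (f : {linear F -> M})
    (g : {linear G -> M}) : fin_free F -> fin_free G -> range f = range g ->
  (forall x, f x = 0 -> ideal_mul mset setT x) ->
  (forall y, g y = 0 -> ideal_mul mset setT y) ->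
  exists h : {linear F -> G}, bijective h /\ forall x, g (h x) = f x.
Proof.
move=> freeF freeG fg fm gm.
have [h hE] : exists h : {linear F -> G}, forall x, g (h x) = f x.
  by apply: fin_free_lift; rewrite // fg.
have [k kE] : exists k : {linear G -> F}, forall y, f (k y) = g y.
  by apply: fin_free_lift; rewrite // fg.
have nil (U V : lmodType R) (p : {linear U -> V}) (q : {linear V -> U}) (r : {linear U -> M}) :
    (forall x, r x = 0 -> ideal_mul mset setT x) -> (forall x, r (q (p x)) = r x) ->
    exists eps : {linear U -> U}, (forall x, q (p x) = x + eps x) /\
      forall x, eps (eps (eps x)) = 0.
  move=> rm rE; have eps_lin : linear (fun x => q (p x) - x).
    by move=> c u v; rewrite (linearP p) (linearP q) scalerBr opprD addrACA.
  exists (mk_linear eps_lin); split=> [y|]; first by rewrite mk_linearE addrC subrK.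
  by apply: linear_nilpotent => y; apply: rm; rewrite linearB rE subrr.
exists h; split=> //; apply: inj_surj_bijective.
  move=> x y /eqP; rewrite -subr_eq0 -linearB => /eqP.
  have [eps [epsE eps0]] := nil _ _ h k f fm (fun x => etrans (kE _) (hE x)).
  move=> hxy; apply/eqP; rewrite -subr_eq0; apply/eqP; move: hxy.
  move: (x - y) => z hz; have : k (h z) = 0 by rewrite hz linear0.
  rewrite epsE => /eqP; rewrite addr_eq0 => /eqP zE.
  have e1 : eps z = - eps (eps z) by rewrite -(linearN eps) -zE.
  have e2 : eps (eps z) = 0 by rewrite e1 (linearN eps) eps0 oppr0.
  by rewrite zE e1 e2 !oppr0.
move=> y; have [eps [epsE eps0]] := nil _ _ k h g gm (fun y => etrans (hE _) (kE y)).
exists (k (y - eps y + eps (eps y))); rewrite epsE !linearD linearN eps0.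
by rewrite addr0 -[_ + _ + (_ - _)]addrA [eps (eps y) + _]addrC subrK subrK.
Qed.

(** Minimal free resolutions are unique up to isomorphism.  The isomorphisms are
    constructed one degree at a time, each mapping the image of the next
    differential onto the image of the next differential. *)
Lemma minimal_resolution_iso (M : lmodType R) (F G : nat -> lmodType R)
    (d : forall i, {linear F i.+1 -> F i}) (p : {linear F 0 -> M})
    (d' : forall i, {linear G i.+1 -> G i}) (p' : {linear G 0 -> M}) :
  minimal_free_resolution mset d p -> minimal_free_resolution mset d' p' ->
  exists h : forall i, {linear F i -> G i},
    (forall i, bijective (h i)) /\ forall i x, h i (d i x) = d' i (h i.+1 x).
Proof.
move=> [freeF [surjp cokp] exF minF] [freeG [surjp' cokp'] exG minG].
have ker_range (U V W : lmodType R) (a : U -> V) (b : V -> W) :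
    exact_at a b 0 -> forall y, b y = 0 <-> exists x, a x = y.
  move=> ab y; have : (range a) y <-> b y = 0 by rewrite ab.
  by case=> ra rb; split=> [/rb[x _ <-]|[x xy]]; [exists x|apply: ra; exists x].
pose good i (h : {linear F i -> G i}) := bijective h /\
  forall y, (exists x, h (d i x) = y) <-> exists z, d' i z = y.
(* An isomorphism compatible with surjections onto the same submodule maps
   kernel onto kernel. *)
have kernels i (h : {linear F i -> G i}) (N : lmodType R) (a : {linear F i -> N})
    (b : {linear G i -> N}) : bijective h -> (forall x, b (h x) = a x) ->
    exact_at (d i) a 0 -> exact_at (d' i) b 0 -> good i h.
  move=> bh ba /ker_range da /ker_range d'b; split=> // y; split.
    move=> [x <-]; apply/d'b; rewrite ba; apply/da; by exists x.
  have [k hK kK] := bh; move=> [z zy].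
  have /da[x xE] : a (k y) = 0 by rewrite -ba kK; apply/d'b; exists z.
  by exists x; rewrite xE kK.
have [h0 h0P] : exists h0, good 0%N h0.
  have [h [bh hE]] : exists h : {linear F 0 -> G 0}, bijective h /\ forall x, p' (h x) = p x.
    apply: minimal_cover_iso => //; first by rewrite surjp surjp'.
    - by move=> x /(ker_range _ _ _ _ _ cokp)[z <-]; apply: minF; exists z.
    - by move=> x /(ker_range _ _ _ _ _ cokp')[z <-]; apply: minG; exists z.
  by exists h; apply: (kernels _ _ _ _ _ bh hE).
have step i (h : {h | good i h}) : exists h' : {h' | good i.+1 h'},
    forall x, sval h (d i x) = d' i (sval h' x).
  case: h => h [/= bh rh].
  have hd_lin : linear (h \o d i) by move=> r u v; rewrite /= !linearP.
  have [h' [bh' h'E]] : exists h' : {linear F i.+1 -> G i.+1},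
      bijective h' /\ forall x, d' i (h' x) = mk_linear hd_lin x.
    apply: minimal_cover_iso => //.
    - apply/seteqP; split=> y.
        by move=> [x _ /= xy]; have [|z zy] := (rh y).1; [exists x|exists z].
      by move=> [z _ zy]; have [|x xy] := (rh y).2; [exists z|exists x].
    - move=> x /= hdx; apply: (minF i.+1).
      have [z <-] : exists z, d i.+1 z = x; last by exists z.
      apply/(ker_range _ _ _ _ _ (exF i)); apply: (bij_inj bh).
      by rewrite hdx linear0.
    - by move=> x /(ker_range _ _ _ _ _ (exG i))[z <-]; apply: (minG i.+1); exists z.
  have gh' : good i.+1 h'.
    apply: (kernels _ _ _ _ _ bh' h'E) => //.
    apply/seteqP; split=> [_ [x _ <-]|x /= hdx].
      have dd : d i (d i.+1 x) = 0 by apply/(ker_range _ _ _ _ _ (exF i)); exists x.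
      by rewrite /= dd linear0.
    have /(ker_range _ _ _ _ _ (exF i))[z <-] : d i x = 0; last by exists z.
    by apply: (bij_inj bh); rewrite hdx linear0.
  by exists (exist _ h' gh') => x /=; rewrite h'E.
pose next i h := projT1 (cid (step i h)).
have nextP i (h : {h : {linear F i -> G i} | good i h}) x : sval h (d i x) = d' i (sval (next i h) x).
  by rewrite /next; case: cid.
pose H := fix H i : {h : {linear F i -> G i} | good i h} :=
  if i is j.+1 then next j (H j) else exist _ h0 h0P.
exists (fun i => sval (H i)); split=> i; first by case: (H i) => h [].
by move=> x; exact: nextP.
Qed.

End Minimal.

(** * Jordan blocks over an exact pair *)

Section Toeplitz.
Variables (R : comUnitRingType) (n : nat).

(** The nilpotent Jordan block. *)
Definition shift_mx : 'M[R]_n := \matrix_(i, j) (j == i.+1 :> nat)%:R.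

(** The Jordan block with [x] on the diagonal and [y] above it. *)
Definition bidiag_mx (x y : R) : 'M[R]_n := x%:M + y *: shift_mx.

(** The upper triangular Toeplitz matrix with first row [s 0, s 1, ...]. *)
Definition toeplitz_mx (s : nat -> R) : 'M[R]_n :=
  \matrix_(i, j) if (i <= j)%N then s (j - i)%N else 0.

(** Multiplication by the shift on the left moves the rows up by one, putting
    zero in the last row. *)
Lemma shift_mulP (i : 'I_n) :
  (exists2 i' : 'I_n, i' = i.+1 :> nat
    & forall p (B : 'M_(n, p)) j, (shift_mx *m B) i j = B i' j) \/
  (i.+1 = n /\ forall p (B : 'M_(n, p)) j, (shift_mx *m B) i j = 0).
Proof.
have [lt_in|le_ni] := ltnP i.+1 n; [left|right].
  exists (Ordinal lt_in) => // p B j; rewrite mxE (bigD1 (Ordinal lt_in)) //=.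
  rewrite mxE eqxx mul1r big1 ?addr0 // => k ki; rewrite mxE -[i.+1]/(val (Ordinal lt_in)).
  by rewrite val_eqE (negbTE ki) mul0r.
split=> [|p B j]; first by apply/eqP; rewrite eqn_leq ltn_ord.
rewrite mxE big1 // => k _; rewrite mxE ltn_eqF ?mul0r //.
exact: leq_trans (ltn_ord k) le_ni.
Qed.

(** Multiplication by the shift on the right moves the columns right by one,
    putting zero in the first column. *)
Lemma mul_shiftP (j : 'I_n) :
  (exists2 j' : 'I_n, j = j'.+1 :> nat
    & forall p (B : 'M_(p, n)) i, (B *m shift_mx) i j = B i j') \/
  (j = 0%N :> nat /\ forall p (B : 'M_(p, n)) i, (B *m shift_mx) i j = 0).
Proof.
case: j => -[|j] lt_jn /=; [right|left].
  by split=> // p B i; rewrite mxE big1 // => k _; rewrite mxE mulr0.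
exists (Ordinal (ltnW lt_jn)) => // p B i.
rewrite mxE (bigD1 (Ordinal (ltnW lt_jn))) //= mxE eqxx mulr1 big1 ?addr0 // => k kj.
by rewrite mxE eqSS eq_sym -[j]/(val (Ordinal (ltnW lt_jn))) val_eqE (negbTE kj) mulr0.
Qed.

Lemma shift_toeplitz s i j : (shift_mx *m toeplitz_mx s) i j =
  if (i < j)%N then s (j - i.+1)%N else 0.
Proof.
have [[i' i'E ->]|[iE ->]] := shift_mulP i; first by rewrite mxE i'E.
by rewrite iE leqNgt ltn_ord.
Qed.

Lemma toeplitz_shift s : toeplitz_mx s *m shift_mx = shift_mx *m toeplitz_mx s.
Proof.
apply/matrixP => i j; rewrite shift_toeplitz.
have [[j' jE ->]|[jE ->]] := mul_shiftP j; last by rewrite jE.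
by rewrite mxE jE ltnS subSS.
Qed.

Lemma bidiag_toeplitz x y s : x * s 0%N = 0 -> (forall i, x * s i.+1 + y * s i = 0) ->
  bidiag_mx x y *m toeplitz_mx s = 0.
Proof.
move=> s0 sS; apply/matrixP => i j.
rewrite mulmxDl mul_scalar_mx -scalemxAl [LHS]mxE [X in X + _]mxE [X in _ + X]mxE.
rewrite shift_toeplitz !mxE; case: ltngtP => ij; last by rewrite ij subnn s0 mulr0 addr0.
  by rewrite -[(j - i)%N]prednK ?subn_gt0 // -subnS sS.
by rewrite !mulr0 addr0.
Qed.

Lemma toeplitz_bidiag x y s :
  toeplitz_mx s *m bidiag_mx x y = bidiag_mx x y *m toeplitz_mx s.
Proof.
by rewrite mulmxDr mulmxDl -scalar_mxC -scalemxAr -scalemxAl toeplitz_shift.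
Qed.

Lemma bidiag_tri x y : tri_const val (bidiag_mx x y) x.
Proof.
split=> [i j|i].
  apply: contraR; rewrite -ltnNge => ji; rewrite !mxE.
  by rewrite -val_eqE /= gtn_eqF // ltn_eqF ?mulr0n ?mulr0 ?addr0 // ltnW.
by rewrite !mxE eqxx ltn_eqF // mulr0 addr0.
Qed.

Lemma toeplitz_tri s : tri_const val (toeplitz_mx s) (s 0%N).
Proof.
split=> [i j|i]; last by rewrite mxE leqnn subnn.
by rewrite mxE; case: leqP => //; rewrite eqxx.
Qed.

Lemma tri_const_tr (A : 'M[R]_n) a :
  tri_const val A a -> tri_const (fun i : 'I_n => n - i)%N A^T a.
Proof.
by case=> Atri Adiag; split=> [i j|i]; rewrite mxE // => /Atri /= ji; lia.
Qed.

(** The statement on columns is the one on rows for the transposes, which are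
    triangular for the reversed order of the indices. *)
Lemma tri_exact_pair (A B : 'M[R]_n) a b : tri_const val A a -> tri_const val B b ->
  A *m B = 0 -> B *m A = 0 -> (forall r, r * a = 0 -> exists s, r = s * b) ->
  (forall u : 'rV_n, u *m A = 0 -> exists v, u = v *m B) /\
  (forall c : 'cV_n, A *m c = 0 -> exists d, c = B *m d).
Proof.
move=> Atri Btri AB BA ab; split; first exact: (tri_exact val_inj Atri Btri BA ab).
move=> c Ac; have [|||||v vE] := @tri_exact _ _ (fun i : 'I_n => n - i)%N A^T B^T a b _ _ _ _ ab c^T.
- by move=> i j ij; apply: val_inj; move: (ltn_ord i) (ltn_ord j) ij => /=; lia.
- exact: tri_const_tr.
- exact: tri_const_tr.
- by rewrite -trmx_mul AB trmx0.
- by rewrite -trmx_mul Ac trmx0.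
- by exists v^T; rewrite -[c]trmxK vE trmx_mul trmxK.
Qed.

Lemma bidiag_exact_pair (m : idealr R) x y s : exact_pair m x (s 0%N) ->
  y \in m -> (forall i, s i \in m) -> (forall i, x * s i.+1 + y * s i = 0) ->
  exact_mx_pair m (bidiag_mx x y) (toeplitz_mx s).
Proof.
move=> xw my ms sS; have xs0 : x * s 0%N = 0.
  by rewrite (exact_pair_mul0 (exact_pairC xw)).
have AB := bidiag_toeplitz xs0 sS; have BA := toeplitz_bidiag x y s.
rewrite AB in BA; have [mx mw annx annw] := xw.
have [rowA colA] := tri_exact_pair (bidiag_tri x y) (toeplitz_tri s) AB BA
  (fun r => (annx r).1).
have [rowB colB] := tri_exact_pair (toeplitz_tri s) (bidiag_tri x y) BA AB
  (fun r => (annw r).1).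
split=> //; split=> i j; rewrite !mxE; last by case: ifP => // _; exact: rpred0.
by rewrite rpredD // ?[y * _]mulrC ?idealMr // rpredMn.
Qed.

End Toeplitz.
Arguments shift_mulP R {n}.
Arguments mul_shiftP R {n}.

(** The first row of a Toeplitz matrix annihilated by a Jordan block.  Each term
    is solved from the previous one, as [y * m] is contained in [x * m]. *)
Lemma partner_sequence (R : comUnitRingType) (m : idealr R) x y w : y \in m -> w \in m ->
  fills_m2 m x -> exists s : nat -> R,
    [/\ s 0%N = w, forall i, s i \in m & forall i, x * s i.+1 + y * s i = 0].
Proof.
move=> my mw fx.
have /choice[f fP] : forall t, exists t', t \in m -> t' \in m /\ x * t' + y * t = 0.
  move=> t; have [mt|_] := boolP (t \in m); last by exists 0.
  have [r mr yt] := fx _ (m2M my mt); exists (- r) => _; rewrite rpredN; split=> //.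
  by rewrite yt mulrN mulrC addNr.
have ms i : iter i f w \in m by elim: i => //= i /fP[].
by exists (fun i => iter i f w); split=> // i; have [] := fP _ (ms i).
Qed.

(** * Length *)

Section Length.
Variables (R : comUnitRingType) (M : lmodType R).

(** The submodule generated by the first [s] terms of the sequence [g]. *)
Definition span_lt (g : nat -> M) s : set M :=
  [set v | exists a : nat -> R, v = \sum_(r < s) a r *: g r].

Lemma span_lt_submodule g s : submodule (span_lt g s).
Proof.
split=> [|u v [a ->] [c ->]|r u [a ->]].
- by exists (fun=> 0); rewrite big1 // => i _; rewrite scale0r.
- exists (fun i => a i + c i); rewrite -big_split; apply: eq_bigr => i _ /=.
  by rewrite scalerDl.
- exists (fun i => r * a i); rewrite scaler_sumr; apply: eq_bigr => i _.
  by rewrite scalerA.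
Qed.

Lemma span_ltZ g s a v : span_lt g s v -> span_lt g s (a *: v).
Proof. by case: (span_lt_submodule g s) => _ _; exact. Qed.

Lemma span_lt_sum g s I (r : seq I) (P : pred I) (F : I -> M) :
  (forall i, P i -> span_lt g s (F i)) -> span_lt g s (\sum_(i <- r | P i) F i).
Proof. exact: (submodule_sum (span_lt_submodule g s)). Qed.

Lemma span_ltS g s v : span_lt g s.+1 v <-> exists u a, span_lt g s u /\ v = u + a *: g s.
Proof.
split=> [[a ->]|[_ [c [[a ->] ->]]]].
  by exists (\sum_(r < s) a r *: g r), (a s); split; [exists a|rewrite big_ord_recr].
exists (fun r => if r == s then c else a r).
rewrite big_ord_recr /= eqxx; congr (_ + _); apply: eq_bigr => r _.
by rewrite ltn_eqF.
Qed.

Lemma span_lt_mono g s s' v : (s <= s')%N -> span_lt g s v -> span_lt g s' v.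
Proof.
move=> /subnK <-; elim: (s' - s)%N => // d IH /IH sv.
by rewrite addSn; apply/span_ltS; exists v, 0; rewrite scale0r addr0.
Qed.

Lemma span_lt_gen g s r : (r < s)%N -> span_lt g s (g r).
Proof.
move=> rs; apply: (span_lt_mono rs); apply/span_ltS; exists 0, 1.
by rewrite scale1r add0r; split=> //; case: (span_lt_submodule g r).
Qed.

(** A sequence of generators, each killed by [m] and nonzero modulo the span of
    the previous ones, gives a composition series. *)
Lemma has_length_span (m : {pred R}) (g : nat -> M) l :
  (forall a, a \notin m -> a \is a GRing.unit) ->
  (forall s a, (s < l)%N -> a \in m -> span_lt g s (a *: g s)) ->
  (forall s, (s < l)%N -> ~ span_lt g s (g s)) ->
  (forall v, span_lt g l v) -> has_length M l.
Proof.
move=> mU gm gN gtot; exists (span_lt g); split.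
- apply/seteqP; split=> [v [a ->]|v ->] /=; first by rewrite big_ord0.
  by case: (span_lt_submodule g 0).
- by apply/seteqP; split.
- by move=> i _; exact: span_lt_submodule.
move=> i il; split; first by move=> v; exact: span_lt_mono.
  by move=> spE; apply: (gN i il); rewrite spE; exact: span_lt_gen.
move=> L sL iL LS; have [L_i|/existsNP[v /not_implyP[Lv niv]]] := pselect (L `<=` span_lt g i).
  by left; apply/seteqP.
right; apply/seteqP; split=> //.
have /span_ltS [u [a [iu vE]]] := LS v Lv.
have ua : a \is a GRing.unit.
  apply: mU; apply/negP => ma; apply: niv; rewrite vE.
  by case: (span_lt_submodule g i) => _ + _; apply=> //; exact: gm.
have Lg : L (g i).
  have -> : g i = a^-1 *: (v - u) by rewrite vE addrC addKr scalerA mulVr ?scale1r.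
  by case: (sL) => _ _; apply; apply: submoduleB => //; exact: iL.
move=> w /span_ltS[u' [a' [iu' ->]]]; case: sL => _ LD LZ.
by apply: LD; [exact: iL|exact: LZ].
Qed.

End Length.

(** A module generated by [E 0, ..., E (n - 1)], each of which generates modulo
    the span of the previous ones a copy of [R / (x)], has length [n] times the
    length of [R / (x)].  The latter is [e' + 1], the classes of [c 0, ..., c
    (e' - 1)] being a basis of [m / (x)]. *)
Lemma has_length_layers (R : comUnitRingType) (m : idealr R) (M : lmodType R)
    (x : R) (n e' : nat) (c : nat -> R) (E : nat -> M) :
  (forall a, a \notin m -> a \is a GRing.unit) ->
  x \in m -> (forall p q, p \in m -> q \in m -> exists r, p * q = r * x) ->
  (forall t, (t < e')%N -> c t \in m) ->
  (forall a, a \in m -> exists r (f : nat -> R), a = r * x + \sum_(t < e') f t * c t) ->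
  (forall r (f : nat -> R), \sum_(t < e') f t * c t = r * x ->
     forall t, (t < e')%N -> f t \in m) ->
  (forall q, (q < n)%N -> span_lt E q (x *: E q)) ->
  (forall q r, (q < n)%N -> span_lt E q (r *: E q) -> exists s, r = s * x) ->
  (forall v, span_lt E n v) ->
  has_length M (n * e'.+1).
Proof.
move=> mU mx m2x mc cgen cind Ex Eind Etot.
(* The generator of index [q * (e' + 1) + t] is [d t *: E q]: the layer [q] is
   climbed through [m / (x)] first, and its last generator is [E q] itself. *)
pose d t := if (t < e')%N then c t else 1.
pose g s := d (s %% e'.+1)%N *: E (s %/ e'.+1)%N.
have gE q t : (t < e'.+1)%N -> g (q * e'.+1 + t)%N = d t *: E q.
  by move=> te; rewrite /g modnMDl modn_small // divnMDl // divn_small // addn0.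
have ge q : g (q * e'.+1 + e')%N = E q by rewrite gE // /d ltnn scale1r.
have EgV q v : span_lt E q v -> span_lt g (q * e'.+1) v.
  move=> [a ->]; apply: span_lt_sum => i _.
  apply: span_ltZ; rewrite -ge.
  apply: span_lt_gen; apply: (@leq_trans (i.+1 * e'.+1)); last by rewrite leq_mul2r ltn_ord orbT.
  by rewrite mulSn addnC ltn_add2r.
(* Modulo the lower layers, the span of the first [t] generators of the layer [q]
   consists of multiples of [E q]. *)
have gEV q t v : span_lt g (q * e'.+1 + t) v -> (t < e'.+1)%N -> exists (f : nat -> R) u,
    span_lt E q u /\ v = u + (\sum_(k < t) f k * d k) *: E q.
  elim: t v => [|t IH] v.
    rewrite addn0 => -[a ->] _; exists (fun=> 0), (\sum_(r < q * e'.+1) a r *: g r).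
    split; last by rewrite big_ord0 scale0r addr0.
    apply: span_lt_sum => i _.
    apply: span_ltZ; apply: span_ltZ.
    by apply: span_lt_gen; rewrite ltn_divLR.
  rewrite addnS => /span_ltS[u [a [/IH uP ->]]] te.
  have [|f [u' [Eu' ->]]] := uP; first exact: ltnW.
  exists (fun k => if k == t then a else f k), u'; split=> //.
  rewrite -addrA; congr (_ + _); rewrite gE 1?ltnW // scalerA -scalerDl.
  rewrite big_ord_recr /= eqxx; congr ((_ + _) *: _); apply: eq_bigr => k _.
  by rewrite ltn_eqF.
have decomp s : (s < n * e'.+1)%N -> exists q t,
    [/\ (q < n)%N, (t < e'.+1)%N & s = (q * e'.+1 + t)%N].
  move=> sl; exists (s %/ e'.+1)%N, (s %% e'.+1)%N.
  by rewrite ltn_divLR // ltn_mod -divn_eq.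
apply: (has_length_span (m := m) (g := g) mU).
- move=> _ a /decomp[q [t [qn te ->]]] ma.
  have [g0 gD gZ] := span_lt_submodule g (q * e'.+1 + t).
  have Sx r : span_lt g (q * e'.+1 + t) ((r * x) *: E q).
    rewrite -scalerA; apply: gZ; apply: (span_lt_mono (leq_addr _ _)).
    exact/EgV/Ex.
  rewrite gE // scalerA; have [te'|et] := ltnP t e'.
    by rewrite /d te'; have [r ->] := m2x _ _ ma (mc _ te').
  have {te}tE : t = e' by apply/eqP; rewrite eqn_leq -ltnS te.
  rewrite {2}tE /d ltnn mulr1; have [r [f ->]] := cgen _ ma.
  rewrite scalerDl; apply: gD => //; rewrite scaler_suml.
  apply: span_lt_sum => k _; rewrite -scalerA; apply: gZ.
  have -> : c k *: E q = g (q * e'.+1 + k)%N by rewrite gE ?ltnS 1?ltnW // /d ltn_ord.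
  by apply: span_lt_gen; rewrite ltn_add2l tE.
- move=> _ /decomp[q [t [qn te ->]]]; rewrite gE // => /gEV /(_ te) [f [u [Eu]]].
  move=> /eqP; rewrite -subr_eq -scalerBl => /eqP uE; move: Eu; rewrite -uE.
  have fd : \sum_(k < t) f k * d k = \sum_(k < t) f k * c k.
    apply: eq_bigr => k _; rewrite /d (leq_trans (ltn_ord k)) //.
  move/(Eind _ _ qn) => [r]; rewrite fd /d; have [te'|et] := ltnP t e'.
    (* A relation that expresses [c t] by the previous terms modulo [x] contradicts
       the independence of the [c k], as its coefficient at [t] is [1]. *)
    pose f' k := if (k < t)%N then - f k else (k == t)%:R.
    move=> cE; have /cind/(_ t te') : \sum_(k < e') f' k * c k = r * x.
      rewrite -cE -(subnKC te') big_split_ord big_ord_recr /= [X in _ + X]big1 ?addr0.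
        rewrite /f' ltnn eqxx mul1r addrC; congr (_ + _).
        by rewrite -sumrN; apply: eq_bigr => k _; rewrite ltn_ord mulNr.
      move=> k _; have tk : (t < t.+1 + k)%N by rewrite addSn ltnS leq_addr.
      by rewrite /f' ltnNge (ltnW tk) gtn_eqF ?mul0r.
    by rewrite /f' ltnn eqxx idealr1.
  have tE : t = e' by apply/eqP; rewrite eqn_leq -ltnS te.
  move/eqP; rewrite subr_eq => /eqP e1; have := idealr1 m.
  rewrite e1 rpredD ?idealMr // rpred_sum // => k _.
  by rewrite idealMr // mc // -tE.
- by move=> v; exact/EgV.
Qed.

(** * Homomorphisms between modules of Jordan blocks *)

Section MatricesModulo.
Variables (R : comUnitRingType) (m : idealr R).

(** All entries lie in [m]. *)
Definition mx_in p q (A : 'M[R]_(p, q)) := forall i j, A i j \in m.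

Lemma mx_inD p q (A B : 'M[R]_(p, q)) : mx_in A -> mx_in B -> mx_in (A + B).
Proof. by move=> mA mB i j; rewrite mxE rpredD. Qed.

Lemma mx_inN p q (A : 'M[R]_(p, q)) : mx_in A -> mx_in (- A).
Proof. by move=> mA i j; rewrite mxE rpredN. Qed.

Lemma mx_inZ p q a (A : 'M[R]_(p, q)) : mx_in A -> mx_in (a *: A).
Proof. by move=> mA i j; rewrite mxE idealMr. Qed.

Lemma mx_inMl p q r (A : 'M[R]_(p, q)) (B : 'M[R]_(q, r)) : mx_in B -> mx_in (A *m B).
Proof. by move=> mB i j; rewrite mxE rpred_sum // => k _; rewrite idealMr. Qed.

Lemma mx_inMr p q r (A : 'M[R]_(p, q)) (B : 'M[R]_(q, r)) : mx_in A -> mx_in (A *m B).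
Proof. by move=> mA i j; rewrite mxE rpred_sum // => k _; rewrite mulrC idealMr. Qed.

Hypothesis mU : forall a, a \notin m -> a \is a GRing.unit.
Let mM a b : a * b \in m -> a \notin m -> b \in m.
Proof. by move=> mab /mU ua; rewrite -[b](mulKr ua) idealMr. Qed.

Variable n : nat.
Local Notation N := (shift_mx R n).

(** The commutator with the shift is nilpotent, so it has no nonzero eigenvalue
    modulo [m]. *)
Lemma commutator_shift_unit c (P : 'M[R]_n) : c \notin m ->
  mx_in (c *: P + (N *m P - P *m N)) -> mx_in P.
Proof.
(* Each entry is determined by those below it and to its left. *)
move=> mc mcP; suff H k : forall i j : 'I_n, (j + (n - i) <= k)%N -> P i j \in m.
  by move=> i j; exact: H (leqnn _).
elim: k => [|k IH] i j jik; first by move: (ltn_ord i); lia.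
have mij : c * P i j + ((N *m P) i j - (P *m N) i j) \in m.
  by have := mcP i j; rewrite !mxE.
have mNP : (N *m P) i j \in m.
  have [[i' i'E NE]|[_ NE]] := shift_mulP R i; rewrite NE ?rpred0 //.
  by apply: IH; move: (ltn_ord i') jik; lia.
have mPN : (P *m N) i j \in m.
  have [[j' jE NE]|[_ NE]] := mul_shiftP R j; rewrite NE ?rpred0 //.
  by apply: IH; move: jik; lia.
by move: mij; rewrite rpredDr ?rpredB // => mcPij; exact: (mM mcPij mc).
Qed.

Section Centralizer.
Variable P : 'M[R]_n.
Hypothesis PN : mx_in (N *m P - P *m N).

(** A matrix that commutes with the shift modulo [m] is modulo [m] upper
    triangular with constant diagonal. *)
Lemma centralizer_shift_lower (i j i0 : 'I_n) : i0 = 0%N :> nat -> (j <= i)%N ->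
  P i j - P i0 i0 *+ (i == j) \in m.
Proof.
move=> i00; have [k] := ubnP (j : nat); elim: k => // k IH in i j * => jk ji.
have PNE i' j' : (N *m P) i' j' - (P *m N) i' j' \in m by have := PN i' j'; rewrite !mxE.
have [i_0|i_gt0] := posnP i.
  have -> : i = i0 by apply: val_inj; rewrite /= i_0 i00.
  have -> : j = i0 by apply: val_inj; rewrite /= i00; move: ji; rewrite i_0; lia.
  by rewrite eqxx subrr rpred0.
have lt_i : (i.-1 < n)%N by move: (ltn_ord i); lia.
pose i' := Ordinal lt_i.
have := PNE i' j; have [[i1 i1E ->]|[iE _]] := shift_mulP R i'; last first.
  by move: (ltn_ord i) iE => /=; lia.
have -> : i1 = i by apply: val_inj; rewrite /= i1E /=; lia.
have [[j' jE ->]|[j0 ->]] := mul_shiftP R j; last first.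
  by rewrite subr0 => mP; rewrite [i == j]gtn_eqF ?subr0 //= j0.
move=> mP; rewrite -(subrK (P i' j') (P i j)) -addrA rpredD //.
have -> : (i == j) = (i' == j') by rewrite -!val_eqE /= jE; lia.
by apply: IH; rewrite /=; lia.
Qed.

(** An idempotent that is strictly upper triangular modulo [m] vanishes modulo
    [m]: its vanishing propagates from one diagonal to the next. *)
Lemma centralizer_shift_idempotent (i0 : 'I_n) : i0 = 0%N :> nat ->
  mx_in (P *m P - P) -> P i0 i0 \in m -> mx_in P.
Proof.
move=> i00 PP mP0.
suff H d : forall i j : 'I_n, (j <= i + d)%N -> P i j \in m.
  by move=> i j; apply: (H n); move: (ltn_ord j); lia.
elim: d => [|d IH] i j jid.
  have := centralizer_shift_lower i00 (_ : (j <= i)%N); rewrite addn0 in jid.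
  by move=> /(_ jid); rewrite rpredBr // rpredMn.
have := PP i j; rewrite !mxE => mPP.
suff : \sum_k P i k * P k j \in m.
  by move=> ms; move: mPP; rewrite rpredBl.
apply: rpred_sum => k _; have [kid|ki] := leqP k (i + d).
  by rewrite mulrC idealMr // IH.
by rewrite idealMr // IH //; lia.
Qed.

Lemma centralizer_shift_diag (i0 : 'I_n) : i0 = 0%N :> nat ->
  mx_in (P *m P - P) -> P i0 i0 \in m \/ 1 - P i0 i0 \in m.
Proof.
move=> i00 PP; have [|mP0] := boolP (P i0 i0 \in m); [by left|right].
have := PP i0 i0; rewrite !mxE (bigD1 i0) //= => mPP.
suff mP : P i0 i0 * (1 - P i0 i0) \in m by exact: (mM mP mP0).
rewrite mulrBr mulr1 -opprB rpredN.
move: mPP; rewrite addrAC rpredDr // rpred_sum // => k ki.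
rewrite idealMr //; have := @centralizer_shift_lower k i0 i0 i00; rewrite i00 leq0n.
by rewrite (negbTE ki) subr0; exact.
Qed.

End Centralizer.

(** A homomorphism between cokernels of matrices lifts to the free covers. *)
Lemma ker_proj_lift (A B A' B' : 'M[R]_n) (AB : exact_mx_pair m A B)
    (AB' : exact_mx_pair m A' B') (h : {linear ker_mod A -> ker_mod A'}) :
  exists P Q : 'M[R]_n, (forall u, h (ker_proj AB u) = ker_proj AB' (u *m P)) /\
    A *m P = Q *m A'.
Proof.
have /choice[r rP] : forall i : 'I_n, exists v, ker_proj AB' v = h (ker_proj AB (delta_mx 0 i)).
  by move=> i; exact: ker_proj_surj.
pose P : 'M[R]_n := \matrix_i r i.
have hP u : h (ker_proj AB u) = ker_proj AB' (u *m P).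
  rewrite [u in LHS]row_sum_delta mulmx_sum_row !linear_sum; apply: eq_bigr => i _.
  by rewrite !linearZ rowK rP.
have /choice[q qP] : forall i : 'I_n, exists v, row i A *m P = v *m A'.
  move=> i; apply/(ker_proj_eq0 AB'); rewrite -hP.
  have -> : ker_proj AB (row i A) = 0; last by rewrite linear0.
  by apply/(ker_proj_eq0 AB); exists (delta_mx 0 i); rewrite -rowE.
exists P, (\matrix_i q i); split=> //.
by apply/row_matrixP => i; rewrite !row_mul qP rowK.
Qed.

End MatricesModulo.

(** * Total reflexivity and periodicity *)

Section Periodicity.
Variables (R : comUnitRingType) (m : idealr R) (n : nat) (A B : 'M[R]_n).
Hypothesis AB : exact_mx_pair m A B.

Lemma fin_free_rV : fin_free ('rV[R]_n : lmodType R).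
Proof. by exists n, (idfun : {linear 'rV[R]_n -> 'rV[R]_n}); exists id. Qed.

(** The two matrices in alternation. *)
Let alt (i : nat) : 'M[R]_n := if odd i then B else A.

Let alt_pair i : exact_mx_pair m (alt i) (alt i.+1).
Proof. by rewrite /alt /=; case: odd => //=; exact: exact_mx_pairC. Qed.

Lemma ker_mod_totally_reflexive : totally_reflexive (ker_mod A).
Proof.
split.
  exists n, (fun i => ker_proj AB (delta_mx 0 i)); apply/seteqP; split=> // z _.
  have [u <-] := ker_proj_surj AB z; exists (fun i => u 0 i).
  by rewrite {1}[u]row_sum_delta linear_sum; apply: eq_bigr => i _; rewrite linearZ.
(* The differentials alternate according to the parity of the degree, also in
   negative degrees, where it is read on the absolute value. *)
have odd_succ (i : int) : odd `|(i + 1)%R|%N = ~~ odd `|i|%N by lia.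
have altS (i : int) : alt `|(i + 1)%R|%N = alt `|i|%N.+1 by rewrite /alt odd_succ.
have altSS (i : int) : alt `|(i + 1)%R|%N.+1 = alt `|i|%N.
  by rewrite /alt /= odd_succ negbK.
exists (fun=> 'rV[R]_n : lmodType R), (fun i => mulmxr (alt `|i|%N)); split.
- by move=> i; exact: fin_free_rV.
- move=> i; rewrite -(altSS i); exact: (mulmxr_exact (alt_pair _)).
- move=> i phi; rewrite -(altSS i); exact: (mulmxr_dual_exact (alt_pair _)).
- by exists (ker_proj AB); exact: ker_proj_coker.
Qed.

Hypothesis m_cube0 : ideal_prod [set x | x \in m]
  (ideal_prod [set x | x \in m] [set x | x \in m]) = [set 0].

(** The resolution that alternates the two matrices is minimal and equal to its
    double shift; every other minimal resolution is isomorphic to it. *)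
Lemma ker_mod_periodic : periodic_minimal_resolution_le2 [set x | x \in m] (ker_mod A).
Proof.
pose F (i : nat) : lmodType R := 'rV[R]_n.
pose d i : {linear F i.+1 -> F i} := mulmxr (alt i).
have stdP : minimal_free_resolution [set x | x \in m] d (ker_proj AB).
  split=> [i|||i]; [exact: fin_free_rV|exact: ker_proj_coker| |].
    move=> i; have -> : d i = mulmxr (alt i.+2) by rewrite /d /alt /= negbK.
    exact: (mulmxr_exact (alt_pair _)).
  exact: (mulmxr_minimal (alt_pair i)).
split; first by exists F, d, (ker_proj AB).
move=> G d' p resG; exists 2%N; split=> //.
have [h [bh hE]] := minimal_resolution_iso m_cube0 resG stdP.
pose k i := projT1 (cid (bijective_linear_inv (bh i))).
have kP i : cancel (h i) (k i) /\ cancel (k i) (h i).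
  exact: projT2 (cid (bijective_linear_inv (bh i))).
have phi_lin i : linear (fun x : G (i + 2)%N => k i (h (i + 2)%N x)).
  by move=> r u v; rewrite (linearP (h _)) (linearP (k _)).
exists (fun i => mk_linear (phi_lin i)); split=> [i|i x].
  have [hK kK] := kP i; have [hK2 kK2] := kP (i + 2)%N.
  exists (fun y => k (i + 2)%N (h i y)) => y; rewrite !mk_linearE.
    by rewrite kK hK2.
  by rewrite kK2 hK.
rewrite !mk_linearE; have [hK kK] := kP i; have [hK1 kK1] := kP i.+1.
have dE u : d (i + 2)%N u = d i u :> 'rV[R]_n by rewrite /d /alt addn2 /= negbK.
by apply: (can_inj hK); rewrite kK !hE kK1; exact: dE.
Qed.

End Periodicity.

(** * Length, isomorphisms and idempotents of the modules *)

Section JordanModules.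
Variables (R : comUnitRingType) (m : idealr R).
Let mset : set R := [set x | x \in m].
Let m2 : set R := ideal_prod mset mset.
Hypothesis m_cube0 : ideal_prod mset m2 = [set 0].
Hypothesis localR : local_with mset.
Variable n : nat.

Let mU a : a \notin m -> a \is a GRing.unit.
Proof. exact: notin_m_unit. Qed.

(** The layers are generated by the images of the unit vectors, from the last one
    to the first; [m / (x)] has for basis the [b i] other than one at which [x]
    has a unit coordinate. *)
Lemma jordan_length e (b : 'I_e -> R) x y s : m_basis m b -> (1 < e)%N ->
  exact_pair m x (s 0%N) ->
  exact_mx_pair m (bidiag_mx n x y) (toeplitz_mx n s) ->
  has_length (ker_mod (bidiag_mx n x y)) (n * e).
Proof.
case: e b => // e' b bP e_gt1 xw AB; have [mx mw annx annw] := xw.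
have [mb bgen bind] := bP.
have fx := exact_pair_fills m_cube0 localR bP e_gt1 (exact_pairC xw).
have [xi xE] := combP m_cube0 bP mx.
have [i0 xi0] : exists i0, xi i0 0 \notin m.
  apply: contrapT => /forallNP mxi.
  apply: (exact_pair_notin_m2 m_cube0 bP e_gt1 (exact_pairC xw)); rewrite xE.
  by apply: (comb_m2 bP) => i; apply: contrapT => /negP; exact: mxi.
(* [c] and [E] are extended by [0] outside their ranges [e'] and [n]. *)
pose c t := if insub t is Some i then b (lift i0 (i : 'I_e')) else 0.
have cE (t : 'I_e') : c t = b (lift i0 t) by rewrite /c valK.
pose E q : ker_mod (bidiag_mx n x y) :=
  if insub (n - q.+1)%N is Some i then ker_proj AB (delta_mx 0 i) else 0.
have EE q (i : 'I_n) : (q + i).+1 = n -> E q = ker_proj AB (delta_mx 0 i).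
  by move=> qi; rewrite /E; have -> : (n - q.+1)%N = i by [lia]; rewrite valK.
have Eidx q : (q < n)%N -> exists i : 'I_n, (q + i).+1 = n.
  by move=> qn; have iP : (n - q.+1 < n)%N by [lia]; exists (Ordinal iP) => /=; lia.
have combI (a : 'cV[R]_e'.+1) : comb b a = a i0 0 * b i0 + \sum_(t < e') a (lift i0 t) 0 * c t.
  by rewrite /comb (bigD1_ord i0) //=; congr (_ + _); apply: eq_bigr => t _; rewrite cE.
apply: (has_length_layers (x := x) (c := c) (E := E) mU mx).
- by move=> p q mp mq; have [r _ ->] := fx _ (m2M mp mq); exists r.
- by move=> t te; rewrite -[t]/(val (Ordinal te)) cE.
- move=> a ma; have [al aE] := combP m_cube0 bP ma.
  (* This multiple of [x] has the same coordinate as [a] at [i0]. *)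
  pose r := al i0 0 / xi i0 0.
  exists r, (fun t => if insub t is Some i then (al - r *: xi) (lift i0 (i : 'I_e')) 0 else 0).
  rewrite (eq_bigr (fun t : 'I_e' => (al - r *: xi) (lift i0 t) 0 * c t)); last first.
    by move=> t _; rewrite valK.
  have al0 : (al - r *: xi) i0 0 = 0 by rewrite !mxE mulrVK ?mU // subrr.
  have := combI (al - r *: xi); rewrite al0 mul0r add0r => <-.
  by rewrite combB combZ -xE -aE addrC subrK.
- move=> r f fE t te.
  pose a : 'cV[R]_e'.+1 := \col_i if unlift i0 i is Some t then f t else 0.
  have aE : comb b a = r * x.
    rewrite combI mxE unlift_none mul0r add0r -fE; apply: eq_bigr => i _.
    by rewrite mxE liftK.
  have mar : forall i, (a - r *: xi) i 0 \in m.
    by apply: bind; rewrite combB combZ aE -xE subrr; case: (m2_submodule m).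
  have mr : r \in m.
    have := mar i0; rewrite !mxE unlift_none sub0r rpredN mulrC => mxr.
    exact: (mM_notin m_cube0 localR mxr).
  have := mar (lift i0 (Ordinal te)); rewrite !mxE liftK /= rpredBr //.
  by rewrite mulrC idealMr.
- move=> [|q] qn; have [i iE] := Eidx _ qn; rewrite (EE _ i) //.
    have -> : x *: ker_proj AB (delta_mx 0 i) = 0.
      rewrite -linearZ; apply/ker_proj_eq0; exists (delta_mx 0 i).
      rewrite mulmxDr mul_mx_scalar -scalemxAr; apply/esym/eqP.
      rewrite -subr_eq0 addrAC subrr add0r; apply/eqP/rowP => j.
      rewrite mxE -rowE !mxE ltn_eqF ?mulr0 //; move: (ltn_ord j) iE; lia.
    by case: (span_lt_submodule E 0).
  have [i' i'E] : exists i' : 'I_n, i' = i.+1 :> nat.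
    by have iP : (i.+1 < n)%N by [lia]; exists (Ordinal iP).
  have -> : x *: ker_proj AB (delta_mx 0 i) = (- y) *: E q.
    rewrite (EE q i'); last by lia.
    apply/eqP; rewrite -subr_eq0 -!linearZ -linearB; apply/eqP/ker_proj_eq0.
    exists (delta_mx 0 i); rewrite mulmxDr mul_mx_scalar -scalemxAr scaleNr opprK.
    congr (_ + _ *: _); apply/rowP => j; rewrite -rowE !mxE eqxx /=.
    by rewrite -i'E val_eqE.
  by apply: span_ltZ; exact: span_lt_gen.
- have valE q (i : 'I_n) r : (q + i).+1 = n -> val (r *: E q) = r *: row i (toeplitz_mx n s).
    by move=> qi; rewrite (EE q i) // rowE -(ker_projE AB).
  move=> q r qn [a rE]; have [i iE] := Eidx _ qn; apply/annw.
  have : val (r *: E q) 0 i = val (\sum_(j < q) a j *: E j) 0 i by rewrite rE.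
  rewrite (valE q i) // !mxE leqnn subnn => ->.
  rewrite (raddf_sum (val : ker_mod (bidiag_mx n x y) -> 'rV_n)) summxE big1 // => j _.
  have [k kE] := Eidx j (ltn_trans (ltn_ord j) qn).
  rewrite [LHS](congr1 (fun u : 'rV_n => u 0 i) (valE j k (a j) kE)) /= !mxE leqNgt.
  by have -> : (i < k)%N by [move: (ltn_ord j); lia]; rewrite mulr0.
- move=> v; have [u <-] := ker_proj_surj AB v.
  rewrite [u]row_sum_delta linear_sum; apply: span_lt_sum => i _.
  rewrite linearZ; apply: span_ltZ; have iP := ltn_ord i.
  by rewrite -(EE (n - i.+1)%N i); [apply: span_lt_gen; lia|lia].
Qed.

End JordanModules.

Section JordanHom.
Variables (R : comUnitRingType) (m : idealr R).
Let mset : set R := [set x | x \in m].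
Let m2 : set R := ideal_prod mset mset.
Hypothesis m_cube0 : ideal_prod mset m2 = [set 0].
Hypothesis localR : local_with mset.
Variables (n : nat) (x0 y : R).
Hypothesis indep : forall p q, m2 (p * x0 + q * y) -> p \in m /\ q \in m.

Let mU a : a \notin m -> a \is a GRing.unit.
Proof. exact: notin_m_unit. Qed.

(** The Jordan block with eigenvalue [l] of the pencil [x0 + l * y]. *)
Definition jordan l : 'M[R]_n := bidiag_mx n (x0 + l * y) y.

(** Comparing the coefficients of [x0] and [y] modulo [m] in [jordan l * P = Q *
    jordan l'] shows that [Q = P] and that [P] intertwines the Jordan blocks of
    [l] and [l']. *)
Lemma jordan_intertwine l l' (P Q : 'M[R]_n) : jordan l *m P = Q *m jordan l' ->
  mx_in m ((l - l') *: P + (shift_mx R n *m P - P *m shift_mx R n)).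
Proof.
set N := shift_mx R n => PQ; pose D := P - Q.
pose C := l *: P + N *m P - (l' *: Q + Q *m N).
have DC i j : D i j * x0 + C i j * y = 0.
  have : (jordan l *m P - Q *m jordan l') i j = 0 by rewrite PQ subrr mxE.
  rewrite /jordan /bidiag_mx -/N mulmxDl mulmxDr mul_scalar_mx mul_mx_scalar.
  rewrite -scalemxAl -scalemxAr => <-; rewrite /D /C.
  by move: (N *m P) (Q *m N) => NP QN; rewrite !mxE; ring.
have DCm i j : D i j \in m /\ C i j \in m.
  by apply: indep; rewrite DC; case: (m2_submodule m).
have -> : (l - l') *: P + (N *m P - P *m N) = C - l' *: D - D *m N.
  rewrite /C /D mulmxBl; move: (N *m P) (Q *m N) (P *m N) => NP QN PN.
  by apply/matrixP => i j; rewrite !mxE; ring.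
have mD : mx_in m D by move=> i j; case: (DCm i j).
apply: mx_inD; last exact/mx_inN/mx_inMr.
apply: mx_inD; last exact/mx_inN/mx_inZ.
by move=> i j; case: (DCm i j).
Qed.

Lemma rV_mx_in_ideal_mul (M : lmodType R) (p : {linear 'rV[R]_n -> M}) (u : 'rV[R]_n) :
  mx_in m u -> ideal_mul mset setT (p u).
Proof.
move=> mu; exists n, (fun i => u 0 i), (fun i => p (delta_mx 0 i)); split=> // [i|].
  exact: mu.
by rewrite {1}[u]row_sum_delta linear_sum; apply: eq_bigr => i _; rewrite linearZ.
Qed.

Section Pair.
Variables (l l' : R) (B B' : 'M[R]_n).
Hypotheses (AB : exact_mx_pair m (jordan l) B) (AB' : exact_mx_pair m (jordan l') B').

Lemma ker_proj_eq0_mx_in u : ker_proj AB u = 0 -> mx_in m u.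
Proof.
by case: (AB) => _ _ [mA _] _ _ /ker_proj_eq0[v ->]; exact: mx_inMl.
Qed.

(** If [l' - l] were a unit, the matrix that lifts an isomorphism would vanish
    modulo [m], which contradicts surjectivity by Nakayama's lemma. *)
Lemma jordan_isomorphic : (0 < n)%N ->
  isomorphic (ker_mod (jordan l')) (ker_mod (jordan l)) -> l' - l \in m.
Proof.
move=> n_gt0 [h [k hK kK]]; apply: contrapT => /negP ll'.
have [P [Q [hP PQ]]] := ker_proj_lift AB' AB h.
have mP : mx_in m P.
  exact: (commutator_shift_unit mU ll' (jordan_intertwine PQ)).
pose i0 := Ordinal n_gt0.
have [u uE] := ker_proj_surj AB' (k (ker_proj AB (delta_mx 0 i0))).
have : mx_in m (delta_mx 0 i0 - u *m P).
  by apply: ker_proj_eq0_mx_in; rewrite linearB -hP uE kK subrr.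
move=> /mx_inD /(_ (mx_inMl u mP)); rewrite subrK => /(_ 0 i0).
by rewrite mxE !eqxx idealr1.
Qed.

Lemma jordan_idempotent (h : {linear ker_mod (jordan l) -> ker_mod (jordan l)}) :
  (0 < n)%N -> (forall z, h (h z) = h z) ->
  (forall z, h z = 0) \/ (forall z, h z = z).
Proof.
move=> n_gt0 hh; pose i0 : 'I_n := Ordinal n_gt0.
have [P [Q [hP PQ]]] := ker_proj_lift AB AB h.
have PN : mx_in m (shift_mx R n *m P - P *m shift_mx R n).
  by have := jordan_intertwine PQ; rewrite subrr scale0r add0r.
(* An idempotent whose lift has its first diagonal entry in [m] maps the module
   into [m] times the module, hence is nilpotent, hence zero. *)
have vanish (g : {linear ker_mod (jordan l) -> ker_mod (jordan l)}) (S : 'M[R]_n) :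
    (forall z, g (g z) = g z) -> (forall u, g (ker_proj AB u) = ker_proj AB (u *m S)) ->
    mx_in m (shift_mx R n *m S - S *m shift_mx R n) ->
    mx_in m (S *m S - S) -> S i0 i0 \in m -> forall z, g z = 0.
  move=> gg gS SN SS mS0 z; rewrite -gg -(gg z).
  apply: (linear_nilpotent m_cube0) => w; have [u <-] := ker_proj_surj AB w.
  rewrite gS; apply: rV_mx_in_ideal_mul; apply: mx_inMl.
  exact: (centralizer_shift_idempotent SN (i0 := i0)).
have PP : mx_in m (P *m P - P).
  move=> i j; have : mx_in m ((delta_mx 0 i : 'rV_n) *m (P *m P - P)).
    by apply: ker_proj_eq0_mx_in; rewrite mulmxBr linearB mulmxA -!hP hh subrr.
  by move/(_ 0 j); rewrite -rowE mxE.
have [mP0|mP0] := centralizer_shift_diag mU PN (i0 := i0) erefl PP.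
  by left; exact: vanish hh hP PN PP mP0.
right=> z; apply/eqP; rewrite eq_sym -subr_eq0; apply/eqP.
have g_lin : linear (fun z => z - h z).
  by move=> r u v; rewrite (linearP h) scalerBr opprD addrACA.
apply: (vanish (mk_linear g_lin) (1%:M - P)).
- by move=> w; rewrite !mk_linearE (linearB h) hh subrr subr0.
- by move=> u; rewrite mk_linearE hP mulmxBr mulmx1 linearB.
- have -> : shift_mx R n *m (1%:M - P) - (1%:M - P) *m shift_mx R n =
      - (shift_mx R n *m P - P *m shift_mx R n).
    by rewrite mulmxBr mulmxBl mulmx1 mul1mx opprB addrC subrKA opprB.
  exact: mx_inN.
- have -> // : (1%:M - P) *m (1%:M - P) - (1%:M - P) = P *m P - P.
  by rewrite mulmxBr mulmx1 mulmxBl mul1mx addrAC subrr add0r opprB.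
- by rewrite !mxE eqxx.
Qed.

(** A decomposition gives an idempotent endomorphism. *)
Lemma jordan_indecomposable : (0 < n)%N -> indecomposable (ker_mod (jordan l)).
Proof.
move=> n_gt0; split.
  exists (ker_proj AB (delta_mx 0 (Ordinal n_gt0))) => /ker_proj_eq0_mx_in.
  by move=> /(_ 0 (Ordinal n_gt0)); rewrite mxE !eqxx idealr1.
move=> X Y sX sY XY0 XYT.
have /choice[h hP] : forall z, exists a, X a /\ Y (z - a).
  by move=> z; have [a [c [Xa Yc ->]]] := XYT z; exists a; rewrite addrC addKr.
have h_uniq z a : X a -> Y (z - a) -> h z = a.
  move=> Xa Yza; have [Xh Yh] := hP z; apply/eqP; rewrite -subr_eq0; apply/eqP.
  suff : (X `&` Y) (h z - a) by rewrite XY0.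
  split; first exact: submoduleB.
  by have -> : h z - a = (z - a) - (z - h z); [rewrite opprB [RHS]addrC subrKA|exact: submoduleB].
have h_lin : linear h.
  move=> r u v; have [Xu Yu] := hP u; have [Xv Yv] := hP v.
  case: (sX) (sY) => _ XD XZ [_ YD YZ]; apply: h_uniq; first by apply: XD => //; exact: XZ.
  by rewrite opprD addrACA -scalerBr; apply: YD => //; exact: YZ.
have [X0 _ _] := sX; have [Y0 _ _] := sY.
have hh z : h (h z) = h z by apply: h_uniq; [case: (hP z)|rewrite subrr].
have [h0|h1] := jordan_idempotent (h := mk_linear h_lin) n_gt0 hh.
- left; apply/seteqP; split=> [z Xz|_ ->] //.
  by rewrite -(h_uniq z z Xz) ?subrr //; exact: h0.
- right; apply/seteqP; split=> [z Yz|_ ->] //.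
  by rewrite -[z]h1 mk_linearE; apply: h_uniq; rewrite ?subr0.
Qed.

End Pair.
End JordanHom.

(** * Parametrization by the residue field *)

(** Hilbert's hotel: the elements of the finite set and those of a sequence
    outside it are moved along the sequence. *)
Lemma injection_avoiding (T : choiceType) (B : set T) :
  infinite_set [set: T] -> finite_set B ->
  exists f : T -> T, injective f /\ forall x, ~ B (f x).
Proof.
move=> Tinf Bfin; have := infinite_setD Tinf Bfin.
have [s Bs] := (finite_seqP B).1 Bfin.
elim/choicePpointed: T => T in B s Bs Tinf Bfin *.
  by case: Tinf; rewrite emptyE; exact: finite_set0.
have Bs1 x : B x -> x \in s by rewrite Bs.
have Bs2 x : x \in s -> B x by rewrite Bs.
move=> /infiniteP/ppcard_leP[c].
have c_inj : injective c by move=> i j; apply: inj; rewrite in_setT.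
have cB i : ~ B (c i) by have [] := @funS _ _ _ _ c i I.
have sc i : c i \notin s by apply/negP => /Bs2; exact: cB.
(* Elements of the finite set go to the even terms of the sequence [c], and its
   term of index [i] to the one of index [2 i + 1]. *)
pose code x j := (x \in s /\ j = (index x s).*2) \/ (exists2 i, x = c i & j = i.*2.+1).
have code_inj x x' j : code x j -> code x' j -> x = x'.
  case=> [[xs ->]|[i -> ->]] [[xs' /eqP e]|[i' -> /eqP e]]; move: e.
  - by rewrite -!muln2 eqn_mul2r /= => /eqP/index_inj ->.
  - by move/eqP; lia.
  - by move/eqP; lia.
  - by rewrite eqSS -!muln2 eqn_mul2r /= => /eqP ->.
have /choice[f fP] : forall x, exists y, (exists2 j, code x j & y = c j) \/
    (y = x /\ forall j, ~ code x j).
  move=> x; have [[j xj]|nx] := pselect (exists j, code x j).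
    by exists (c j); left; exists j.
  by exists x; right; split=> // j xj; apply: nx; exists j.
exists f; split=> [x x'|x].
  have [[j xj ->]|[-> nx]] := fP x; have [[j' xj' ->]|[-> nx']] := fP x'.
  - by move/c_inj => jj'; apply: (code_inj _ _ j) => //; rewrite jj'.
  - by move=> cE; case: (nx' j.*2.+1); right; exists j.
  - by move=> cE; case: (nx j'.*2.+1); right; exists j'.
  - by [].
have [[j xj ->]|[-> nx]] := fP x; first exact: cB.
by move=> /Bs1 xs; apply: (nx (index x s).*2); left.
Qed.

(** For a finite list [s] of all the elements, the product of the [X - a] plus
    [1] has no root. *)
Lemma closed_field_infinite (K : comNzRingType) :
  GRing.closed_field_axiom K -> infinite_set [set: K].
Proof.
move=> Kclosed /finite_seqP[s sE].
have sT x : x \in s by have : [set: K] x by []; rewrite sE.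
pose p : {poly K} := \prod_(a <- s) ('X - a%:P).
have s_gt0 : (0 < size s)%N by case: (s) (sT 0).
have size_p : size p = (size s).+1 by rewrite size_prod_XsubC.
have [x xE] := Kclosed (size s) (fun i => - (p + 1)`_i) s_gt0.
have root_x : (p + 1).[x] = 0.
  rewrite (@horner_coef_wide _ (size s).+1); last first.
    by rewrite (leq_trans (size_polyD _ _)) // size_p size_poly1 geq_max leqnn.
  rewrite big_ord_recr /= coefD coef1 gtn_eqF // addr0.
  have -> : p`_(size s) = 1.
    by have := monic_prod_XsubC s predT id; rewrite monicE lead_coefE size_p => /eqP.
  rewrite mul1r xE -big_split big1 // => i _ /=.
  by rewrite mulNr addrN.
move: root_x; rewrite hornerD hornerC horner_prod (big_rem x) //= hornerXsubC subrr.
by rewrite mul0r add0r => /eqP; rewrite oner_eq0.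
Qed.

Section ResidueField.
Variables (R : comUnitRingType) (m : idealr R).
Hypothesis mM : forall a b, a * b \in m -> a \notin m -> b \in m.

(** A polynomial with as many zeros modulo [m], distinct modulo [m], as
    coefficients vanishes modulo [m]. *)
Lemma coefs_mod_roots (f : {poly R}) (s : seq R) :
  pairwise (fun a b => b - a \notin m) s -> {in s, forall a, f.[a] \in m} ->
  (size f <= size s)%N -> forall i, f`_i \in m.
Proof.
elim: s f => [|a s IH] f /=.
  by rewrite leqn0 size_poly_eq0 => _ _ /eqP -> i; rewrite coef0 rpred0.
move=> /andP[/allP as_ s_pw] f_s sz.
have [q qE] : exists q, f - f.[a]%:P = q * ('X - a%:P).
  by apply/factor_theorem; rewrite /root !hornerE subrr.
have fE : f = q * ('X - a%:P) + f.[a]%:P by rewrite -qE subrK.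
have ma : f.[a] \in m by apply: f_s; rewrite inE eqxx.
have mq : forall i, q`_i \in m.
  apply: IH => // [c cs|].
    apply: (@mM (c - a)); last exact: as_.
    have -> : (c - a) * q.[c] = f.[c] - f.[a].
      by rewrite [in f.[c]]fE !hornerE addrK mulrC.
    by rewrite rpredB // f_s // inE cs orbT.
  have [->|q0] := eqVneq q 0; first by rewrite size_poly0.
  have : (size (f - f.[a]%:P)%R <= (size s).+1)%N.
    rewrite (leq_trans (size_polyD _ _)) // geq_max sz size_polyN.
    exact: leq_trans (size_polyC_leq1 _) _.
  by rewrite qE size_Mmonic ?monicXsubC // size_XsubC addn2.
move=> i; rewrite fE mulrBr !coefD coefN coefMX coefMC coefC.
rewrite rpredD ?rpredB //; last by case: ifP => // _; exact: rpred0.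
  by case: ifP => // _; exact: rpred0.
by rewrite mulrC idealMr.
Qed.

Lemma finite_mod_roots (f : {poly R}) : f.[0] = 1 ->
  finite_set [set l : {ideal_quot m} | f.[repr l] \in m].
Proof.
move=> f0; apply: contrapT => /(@infinite_set_fset _ _ (size f)) [B Bf szB].
suff : f`_0 \in m by rewrite -horner_coef0 f0 idealr1.
apply: (@coefs_mod_roots f [seq repr l | l <- B]); last by rewrite size_map.
  rewrite pairwise_map; have := fset_uniq B; rewrite uniq_pairwise.
  apply: sub_pairwise => l l' /=; apply: contra.
  by rewrite Quotient.idealrBE !reprK eq_sym.
by move=> _ /mapP[l lB ->]; exact: Bf.
Qed.

End ResidueField.

Lemma cotangent_dim_basis (R : comUnitRingType) (m : idealr R) e :
  cotangent_dim [set x : R | x \in m] e -> exists b : 'I_e -> R, m_basis m b.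
Proof.
move=> [b [mb bgen bind]]; exists b; split=> // [y /bgen[a m2a]|a m2a].
  exists (\col_i a i); congr (ideal_prod _ _ (_ - _)): m2a.
  by apply: eq_bigr => i _; rewrite mxE.
by apply: (bind (fun i => a i 0)).
Qed.

(** If [e = 0] then [m = 0] and there is no exact zero divisor; if [e = 1] then
    [m] is principal and the ring is a chain ring. *)
Lemma cotangent_dim_gt1 (R : comUnitRingType) (m : idealr R) e (b : 'I_e -> R) :
  ideal_prod [set x | x \in m] (ideal_prod [set x | x \in m] [set x | x \in m])
    = [set 0] ->
  local_with [set x : R | x \in m] -> ~ gorenstein R -> m_basis m b ->
  (exists x : R, exact_zero_divisor x) -> (1 < e)%N.
Proof.
move=> m_cube0 localR nG bP [x [ux x0 _]].
case: e b bP => [|[|e]] b bP //.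
  have mx : x \in m by apply: contrapT => /negP /(notin_m_unit m_cube0 localR); apply/negP.
  have [a xE] := combP m_cube0 bP mx.
  by move: x0; rewrite xE /comb big_ord0 eqxx.
case: nG; apply: (@chain_ring_gorenstein R (b 0) 3).
  by have [mb _ _] := bP; rewrite !exprS expr0 mulr1 (m3_eq0 m_cube0).
move=> a; have [ma|/(notin_m_unit m_cube0 localR)] := boolP (a \in m); last by left.
have [c ->] := combP m_cube0 bP ma.
by right; exists (c 0 0); rewrite /comb big_ord1 mulrC.
Qed.

Unset Implicit Arguments.

Theorem mainTheorem4 (R : comUnitRingType) (m : idealr R) (e : nat)
    (noethR : noetherian R)
    (localR : local_with [set x : R | x \in m])
    (m_cube0 : ideal_prod [set x : R | x \in m]
                 (ideal_prod [set x : R | x \in m] [set x : R | x \in m])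
               = [set 0])
    (nGorR : ~ gorenstein R)
    (dim_e : cotangent_dim [set x : R | x \in m] e)
    (ezdR : exists x : R, exact_zero_divisor x)
    (k_closed : GRing.closed_field_axiom {ideal_quot m}) :
  forall n : nat, (0 < n)%N ->
  exists M : {ideal_quot m} -> lmodType R,
    [/\ forall l, indecomposable (M l),
        forall l l', isomorphic (M l) (M l') -> l = l',
        forall l, totally_reflexive (M l),
        forall l, has_length (M l) (n * e)
      & forall l, periodic_minimal_resolution_le2 [set x : R | x \in m] (M l)].
Proof.
move=> n n_gt0.
have [b bP] := cotangent_dim_basis dim_e.
have e_gt1 := cotangent_dim_gt1 m_cube0 localR nGorR bP ezdR.
have [x0 /(exact_zero_divisor_pair m_cube0 localR)[w0 xw0]] := ezdR.
have [y [f [my indep f0 fP]]] := exact_pair_pencil m_cube0 localR bP e_gt1 xw0.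
have mM := @mM_notin R m m_cube0 localR.
have [g [g_inj gf]] := injection_avoiding (closed_field_infinite k_closed)
  (finite_mod_roots mM f0).
pose lam (l : {ideal_quot m}) : R := repr (g l).
have /choice[s sP] : forall l, exists s : nat -> R,
    exact_pair m (x0 + lam l * y) (s 0%N) /\
    exact_mx_pair m (jordan n x0 y (lam l)) (toeplitz_mx n s).
  move=> l; have [w xw] : exists w, exact_pair m (x0 + lam l * y) w.
    by apply: fP; apply/negP; exact: gf.
  have [mx mw _ _] := xw.
  have fx := exact_pair_fills m_cube0 localR bP e_gt1 (exact_pairC xw).
  have [s [s0 ms sS]] := partner_sequence my mw fx.
  by exists s; rewrite s0; split=> //; apply: bidiag_exact_pair; rewrite ?s0.
have AB l := (sP l).2.
exists (fun l => ker_mod (jordan n x0 y (lam l))); split=> [l|l l' iso|l|l|l].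
- exact: (jordan_indecomposable m_cube0 localR indep (AB l)).
- have := jordan_isomorphic m_cube0 localR indep (AB l') (AB l) n_gt0 iso.
  by rewrite Quotient.idealrBE !reprK => /eqP/g_inj.
- exact: (ker_mod_totally_reflexive (AB l)).
- exact: (jordan_length m_cube0 localR bP e_gt1 (sP l).1 (AB l)).
- exact: (ker_mod_periodic (AB l)).
Qed.
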